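(* The set of all $f\in\mathbb{N}^\mathbb{N}$ that name a Banach space presentation is $\Pi^0_2$-complete.
   Context: The scalar field $\mathbb{F}$ is $\mathbb{R}$ or $\mathbb{C}$; $\mathbb{F}_\mathbb{Q}=\mathbb{F}\cap\mathbb{Q}(i)$. A presentation of a Banach space $\mathcal{B}$ is a pair $(\mathcal{B},R)$ with $R:\mathbb{N}\to\mathcal{B}$ having linearly dense range. Its rational vectors are the finite $\mathbb{F}_\mathbb{Q}$-linear combinations of the $R(n)$, coded by natural numbers via a fixed Gödel numbering of formal expressions $\sum_{j\le M}\alpha_j\overline{v_j}$. With $I_n$ the $n$-th rational open interval in a fixed effective enumeration, the diagram of the presentation is the set of codes of pairs $(m,n)$ such that the norm of the $m$-th rational vector lies in $I_n$. A name of the presentation is any $f\in\mathbb{N}^\mathbb{N}$ whose range is its diagram; $f$ names a Banach space presentation if it is a name of some presentation of some Banach space (possibly the zero space). A set $S\subseteq\mathbb{N}^\mathbb{N}$ is $\Pi^0_2$-complete if it is (lightface) $\Pi^0_2$ and for every $\Pi^0_2$ set $P\subseteq\mathbb{N}^\mathbb{N}$ there is a computable operator $F$ with $P(f)\iff F(f)\in S$. *)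

(* Defs.v *)
From HB Require Import structures.
From mathcomp Require Import all_boot all_order all_algebra.
From mathcomp Require Import all_classical all_reals all_analysis.
From mathcomp Require Import complex.
From mathcomp Require Import Rstruct Rstruct_topology.

Set Implicit Arguments.
Unset Strict Implicit.
Unset Printing Implicit Defensive.

Import Order.TTheory GRing.Theory Num.Theory.
Import numFieldNormedType.Exports.

Definition cpair (x y : nat) : nat := (((x + y) * (x + y).+1)./2 + y)%N.

Fixpoint unpair (n : nat) : nat * nat :=
  match n with
  | 0 => (0, 0)
  | n'.+1 =>
      let (x, y) := unpair n' in
      match x with
      | 0 => (y.+1, 0)
      | x'.+1 => (x', y.+1)
      end
  end.

(* Codes of unary partial recursive functions (Kleene-style, using the
   pairing function to handle several arguments). *)
Inductive prf : Type :=
| Zero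
| Succ
| Ident
| Fst
| Snd
| Comp (f g : prf)
| Pair (f g : prf)
| Prec (f g : prf)
| Mu (f : prf).

Inductive eval : prf -> nat -> nat -> Prop :=
| evZero x : eval Zero x 0
| evSucc x : eval Succ x x.+1
| evId x : eval Ident x x
| evFst x : eval Fst x (unpair x).1
| evSnd x : eval Snd x (unpair x).2
| evComp f g x y z : eval g x y -> eval f y z -> eval (Comp f g) x z
| evPair f g x y z : eval f x y -> eval g x z -> eval (Pair f g) x (cpair y z)
| evPrec0 f g x y : eval f x y -> eval (Prec f g) (cpair x 0) y
| evPrecS f g x n y z :
    eval (Prec f g) (cpair x n) y -> eval g (cpair x (cpair n y)) z ->
    eval (Prec f g) (cpair x n.+1) z
| evMu f x n :
    eval f (cpair x n) 0 ->
    (forall k, (k < n)%N -> exists v, eval f (cpair x k) v.+1) ->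
    eval (Mu f) x n.

Definition total (e : prf) : Prop := forall x, exists y, eval e x y.

Fixpoint code_seq (s : seq nat) : nat :=
  match s with
  | [::] => 0
  | x :: s' => (cpair x (code_seq s')).+1
  end.

Definition init_code (f : nat -> nat) (m : nat) : nat := code_seq (mkseq f m).

(* Lightface Pi^0_2 subsets of N^N (Kleene normal form):
   P f <-> forall n, exists m, R(n, m, f|m) with R recursive. *)
Definition Pi02 (P : (nat -> nat) -> Prop) : Prop :=
  exists e : prf, total e /\
    forall f, P f <-> forall n, exists m, eval e (cpair n (cpair m (init_code f m))) 0.

(* Computable operators N^N -> N^N (type-2 computability): a total recursive
   function e reads (n, f|m) and either answers 0 ("need more of f") or
   k.+1, where k must be F f n; for large enough m an answer is given. *)
Definition computable_operator (F : (nat -> nat) -> nat -> nat) : Prop :=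
  exists e : prf, total e /\
    forall f n,
      (exists m, eval e (cpair n (init_code f m)) (F f n).+1) /\
      (forall m k, eval e (cpair n (init_code f m)) k.+1 -> k = F f n).

Definition Pi02_complete (S : (nat -> nat) -> Prop) : Prop :=
  Pi02 S /\
  forall P, Pi02 P ->
    exists F, computable_operator F /\ forall f, P f <-> S (F f).

Local Open Scope ring_scope.
Local Open Scope classical_set_scope.

Definition Fsc (cplx : bool) : numFieldType :=
  if cplx then (complex Rdefinitions.R : numFieldType)
  else (Rdefinitions.R : numFieldType).

(* F_Q = F cap Q(i): rationals, resp. Gaussian rationals (re, im). *)
Definition FQ (cplx : bool) : countType :=
  if cplx then ((rat * rat)%type : countType) else (rat : countType).

Definition FQ_emb (cplx : bool) : FQ cplx -> Fsc cplx :=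
  match cplx return FQ cplx -> Fsc cplx with
  | true => fun q => ((ratr q.1 : Rdefinitions.R) +i* (ratr q.2 : Rdefinitions.R))%C
  | false => fun q => (ratr q : Rdefinitions.R)
  end.

Section Presentation.
Variable cplx : bool.
Variable B : completeNormedModType (Fsc cplx).
Variable R : nat -> B.

Definition lin_span : set B :=
  [set x | exists s : seq (Fsc cplx * nat), x = \sum_(p <- s) p.1 *: R p.2].

Definition linearly_dense : Prop := closure lin_span = setT.

(* Formal expressions sum_j alpha_j \bar{v_j}, Goedel-numbered by the
   (effective) countType coding of seq (F_Q * nat). *)
Definition rat_expr := seq (FQ cplx * nat).

Definition expr_val (s : rat_expr) : B := \sum_(p <- s) FQ_emb p.1 *: R p.2.

(* The n-th rational open interval (lo, hi), lo < hi, in the effective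
   enumeration given by the countType coding of rat * rat. *)
Definition rat_interval (n : nat) (lo hi : rat) : Prop :=
  pickle_inv n = Some (lo, hi) /\ lo < hi.

Definition diagram : set nat :=
  [set k | exists (m n : nat) (s : rat_expr) (lo hi : rat),
      k = pickle (m, n) /\ pickle_inv m = Some s /\ rat_interval n lo hi /\
      (ratr lo : Fsc cplx) < `|expr_val s| < ratr hi].

Definition is_name (f : nat -> nat) : Prop := forall k, (exists i, f i = k) <-> diagram k.

End Presentation.

Definition names_Banach_presentation (cplx : bool) (f : nat -> nat) : Prop :=
  exists (B : completeNormedModType (Fsc cplx)) (R : nat -> B),
    linearly_dense R /\ is_name R f.

(* Main.v *)
(* A set of naturals is the diagram of a presentation exactly when the intervals it
attaches to each rational expression [s] shrink to a real number [p s] and [p] is a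
seminorm on formal rational combinations: such a [p] extends to the polynomials over
the scalar field (formal combinations of the powers of X), and completing that
seminormed space gives the Banach space.  Spelled out on the enumeration, this is a
conjunction of conditions "for all rational data there are witnesses such that a
decidable relation holds", i.e. a Pi^0_2 predicate.  For hardness, enumerate the
diagram of the zero space, releasing its [j]-th entry only once the first [j + 1]
instances of the given Pi^0_2 predicate have been verified: if one of them fails, the
range is finite, while the diagram of a presentation never is. *)

From HB Require Import structures.
From mathcomp Require Import all_boot all_order all_algebra.
From mathcomp Require Import all_classical all_reals all_analysis.
From mathcomp Require Import ring_quotient generic_quotient.
From mathcomp Require Import complex Rstruct Rstruct_topology.
From mathcomp Require Import zify ring lra.
Require Import Defs.

Set Implicit Arguments.
Unset Strict Implicit.
Unset Printing Implicit Defensive.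

Import Order.TTheory GRing.Theory Num.Theory.
Import numFieldNormedType.Exports.
Import Quotient.Exports.

(** Homogeneity cannot be tested on rational data in the form [p (q s) = |q| p s], because the
    modulus of a Gaussian rational is in general irrational. Homogeneity and subadditivity are
    therefore merged into one inequality [p s <= a * p t + b * p u], whenever [s = q t + r u], with
    rational upper bounds [a], [b] of the moduli; the moduli themselves come back as infima of such
    bounds. Only identities [s = q t + r u] of the free vector space on the generators enter. These
    are decidable, whereas equality of vectors in a Banach space is not.

    A second obstacle is that [p] is known on rational combinations only, while the space needs a
    seminorm homogeneous for all scalars. The extension is an infimum over rational approximations,
    with the error charged in a weighted l^1 norm. This gives a single formula, without
    approximating sequences whose choice would have to be shown irrelevant.

    For hardness, the zero space is enough because even the empty expression has norm 0 in
    infinitely many rational intervals, so a finite range names nothing. *)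

Local Notation RR := Rdefinitions.R.

(** * Partial recursive functions *)

Lemma cpairS x y : cpair x y.+1 = (cpair x.+1 y).+1.
Proof. by rewrite /cpair addSnnS addnS. Qed.

Lemma cpair_next y : cpair y.+1 0 = (cpair 0 y).+1.
Proof.
rewrite /cpair !addn0 add0n.
have -> : y.+1 * y.+2 = y * y.+1 + (y.+1).*2 by nia.
by rewrite halfD odd_double andbF doubleK addnS.
Qed.

Lemma unpairK n : cpair (unpair n).1 (unpair n).2 = n.
Proof.
elim: n => //= n IH; case: (unpair n) IH => -[|x] y /= <-.
  exact: cpair_next.
exact: cpairS.
Qed.

Lemma unpairS n : unpair n.+1 =
  if unpair n is (x'.+1, y) then (x', y.+1) else ((unpair n).2.+1, 0).
Proof. by rewrite /=; case: (unpair n) => -[]. Qed.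

Lemma cpairK x y : unpair (cpair x y) = (x, y).
Proof.
have [n] := ubnP (cpair x y); elim: n x y => // n IH [|x] [|y] h //.
- by move: h; rewrite cpairS ltnS => h; rewrite unpairS IH.
- by move: h; rewrite cpair_next ltnS => h; rewrite unpairS IH.
- by move: h; rewrite cpairS ltnS => h; rewrite unpairS IH.
Qed.

Lemma cpair_inj x y x' y' : cpair x y = cpair x' y' -> x = x' /\ y = y'.
Proof. by move/(congr1 unpair); rewrite !cpairK => -[]. Qed.

Lemma leq_cpairr x y : y <= cpair x y.
Proof. by rewrite /cpair leq_addl. Qed.

Lemma eval_fun e x y z : eval e x y -> eval e x z -> y = z.
Proof.
elim: e x y z => [||||| f IHf g IHg|f IHf g IHg|f IHf g IHg|f IHf] x y z h1 h2.
1-5: by inversion h1; inversion h2; subst.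
- inversion h1; inversion h2; subst.
  have e : y0 = y1 by apply: IHg; eassumption.
  by subst; apply: IHf; eassumption.
- inversion h1; inversion h2; subst.
  by congr cpair; [apply: IHf; eassumption|apply: IHg; eassumption].
(* The rules for [Prec] speak of inputs of the form [cpair x n]. Every number has this form, so the
   induction runs on the second component. *)
- rewrite -(unpairK x) in h1 h2.
  elim: (unpair x).2 y z h1 h2 => [|n IHn] y z h1 h2.
    inversion h1 as [| | | | | | |f1 g1 x1 y1 ev1 ea eb ec
      |f1 g1 x1 n1 y1 z1 ev1 ev1' ea eb ec|]; subst;
    inversion h2 as [| | | | | | |f2 g2 x2 y2 ev2 ea2 eb2 ec2
      |f2 g2 x2 n2 y2 z2 ev2 ev2' ea2 eb2 ec2|]; subst;
    try (by case: (cpair_inj eb)); try (by case: (cpair_inj eb2)).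
    case: (cpair_inj eb) => ? _; case: (cpair_inj eb2) => ? _; subst.
    by apply: IHf; eassumption.
  inversion h1 as [| | | | | | |f1 g1 x1 y1 ev1 ea eb ec
      |f1 g1 x1 n1 y1 z1 ev1 ev1' ea eb ec|]; subst;
  inversion h2 as [| | | | | | |f2 g2 x2 y2 ev2 ea2 eb2 ec2
      |f2 g2 x2 n2 y2 z2 ev2 ev2' ea2 eb2 ec2|]; subst;
  try (by case: (cpair_inj eb)); try (by case: (cpair_inj eb2)).
  case: (cpair_inj eb) => ? [?]; case: (cpair_inj eb2) => ? [?]; subst.
  have e : y1 = y2 by apply: IHn; eassumption.
  by subst; apply: IHg; eassumption.
- inversion h1 as [| | | | | | | | |f1 x1 n1 a1 b1]; subst.
  inversion h2 as [| | | | | | | | |f2 x2 n2 a2 b2]; subst.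
  case: (ltngtP y z) => // h.
    by have [v hv] := b2 _ h; have := IHf _ _ _ a1 hv.
  by have [v hv] := b1 _ h; have := IHf _ _ _ a2 hv.
Qed.

Definition natcomp (g : nat -> nat) := exists e, forall n, eval e n (g n).

Lemma eq_natcomp g h : g =1 h -> natcomp g -> natcomp h.
Proof. by move=> gh [e he]; exists e => n; rewrite -gh. Qed.

Lemma natcomp_id : natcomp id.
Proof. by exists Ident => n; constructor. Qed.

Lemma natcomp_fst : natcomp (fun n => (unpair n).1).
Proof. by exists Fst => n; constructor. Qed.

Lemma natcomp_snd : natcomp (fun n => (unpair n).2).
Proof. by exists Snd => n; constructor. Qed.

Lemma natcomp_succ : natcomp succn.
Proof. by exists Succ => n; constructor. Qed.

Lemma natcomp_comp g h : natcomp g -> natcomp h -> natcomp (fun n => g (h n)).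
Proof.
by move=> [e he] [d hd]; exists (Comp e d) => n; apply: evComp (hd n) (he _).
Qed.

Lemma natcomp_pair g h : natcomp g -> natcomp h -> natcomp (fun n => cpair (g n) (h n)).
Proof. by move=> [e he] [d hd]; exists (Pair e d) => n; constructor. Qed.

Lemma natcomp_const c : natcomp (fun=> c).
Proof.
elim: c => [|c IH]; first by exists Zero => n; constructor.
exact: natcomp_comp natcomp_succ IH.
Qed.

Lemma natcomp_rec g h k : natcomp g -> natcomp h -> natcomp k ->
  natcomp (fun x => nat_rect (fun=> nat) (g x)
    (fun n r => h (cpair x (cpair n r))) (k x)).
Proof.
move=> [e he] [d hd] ck.
have [c hc] := natcomp_pair natcomp_id ck.
exists (Comp (Prec e d) c) => x; apply: evComp (hc x) _.
elim: (k x) => [|n IH] /=; first exact: evPrec0.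
exact: evPrecS IH _.
Qed.

Lemma natcomp_mu b (g : nat -> nat) : natcomp b ->
  (forall x, b (cpair x (g x)) = 0) -> (forall x k, k < g x -> 0 < b (cpair x k)) ->
  natcomp g.
Proof.
move=> [e he] h1 h2; exists (Mu e) => x; constructor; first by rewrite -(h1 x).
by move=> k /h2 h; exists (b (cpair x k)).-1; rewrite prednK.
Qed.

(** * Numbered types *)

(* Numberings are only surjective: a rational number has many codes, so arithmetic
   never has to normalise fractions. *)
Class numbered (T : Type) :=
  { nu : nat -> T; nu_surj : forall x, exists n, nu n = x }.

#[global] Instance numbered_nat : numbered nat.
Proof. by exists id => x; exists x. Defined.

#[global] Instance numbered_bool : numbered bool.
Proof. by exists (fun n => 0 < n) => -[]; [exists 1|exists 0]. Defined.

#[global] Instance numbered_prod A B {nA : numbered A} {nB : numbered B} :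
  numbered (A * B).
Proof.
exists (fun n => (nu (unpair n).1, nu (unpair n).2)) => -[a b].
have [x <-] := nu_surj a; have [y <-] := nu_surj b.
by exists (cpair x y); rewrite cpairK.
Defined.

Lemma nu_pair A B {nA : numbered A} {nB : numbered B} x y :
  nu (cpair x y) = (nu x, nu y) :> A * B.
Proof. by rewrite /nu /= cpairK. Qed.

(** The code of the tail is smaller than that of the list but not a subterm of it, hence the fuel;
    [n] steps suffice for the code [n]. This inverts [code_seq], so that [init_code f m] is itself a
    code of the prefix [mkseq f m]. *)
Fixpoint decode_fuel (k n : nat) : seq nat :=
  match k, n with
  | k'.+1, n'.+1 => (unpair n').1 :: decode_fuel k' (unpair n').2
  | _, _ => [::]
  end.

Definition decode_seq n := decode_fuel n n.

Lemma leq_unpair2 n : (unpair n).2 <= n.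
Proof. by rewrite -{2}(unpairK n) leq_cpairr. Qed.

Lemma decode_fuelE k n : n <= k -> decode_fuel k n = decode_seq n.
Proof.
rewrite /decode_seq; have [m] := ubnP n; elim: m k n => // m IH [|k] [|n] //= nm nk.
have h := leq_unpair2 n.
by rewrite !IH//; lia.
Qed.

Lemma decode_seqS n : decode_seq n.+1 = (unpair n).1 :: decode_seq (unpair n).2.
Proof. by rewrite {1}/decode_seq /= decode_fuelE// leq_unpair2. Qed.

Lemma code_seqK : cancel code_seq decode_seq.
Proof. by elim=> //= x s IH; rewrite decode_seqS cpairK /= IH. Qed.

Lemma size_decode_seq n : size (decode_seq n) <= n.
Proof. by rewrite /decode_seq; elim: n {2}n => [|k IH] [|n] //=; rewrite ltnS. Qed.

#[global] Instance numbered_seq A {nA : numbered A} : numbered (seq A).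
Proof.
exists (fun n => map nu (decode_seq n)).
elim=> [|a s [n hn]]; first by exists 0.
have [x hx] := nu_surj a; exists (cpair x n).+1.
by rewrite decode_seqS cpairK /= hx hn.
Defined.

Lemma nu_seqS A {nA : numbered A} n :
  nu n.+1 = nu (unpair n).1 :: nu (unpair n).2 :> seq A.
Proof. by rewrite {1}/nu /numbered_seq decode_seqS. Qed.

(** The tracking function must accept every code of an argument but may return any code of the
    value; two codes of one argument may lead to different codes of the same value. *)
Definition cmp {T U} {nT : numbered T} {nU : numbered U} (f : T -> U) : Prop :=
  exists2 g, natcomp g & forall n, nu (g n) = f (nu n).

(** * Closure properties of computable maps between numbered types *)

Section Closure.
Context {T : Type} {nT : numbered T}.

Lemma eq_cmp {U} {nU : numbered U} (f g : T -> U) : f =1 g -> cmp f -> cmp g.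
Proof. by move=> fg [h ch hh]; exists h => // n; rewrite hh fg. Qed.

Lemma cmp_id : cmp (fun x : T => x).
Proof. by exists id => //; exact: natcomp_id. Qed.

Lemma cmp_const {U} {nU : numbered U} (u : U) : cmp (fun _ : T => u).
Proof. by have [n <-] := nu_surj u; exists (fun=> n) => //; exact: natcomp_const. Qed.

Lemma cmp_comp {U V} {nU : numbered U} {nV : numbered V} (f : U -> V) (g : T -> U) :
  cmp f -> cmp g -> cmp (fun x => f (g x)).
Proof.
move=> [f' cf hf] [g' cg hg]; exists (fun n => f' (g' n)); first exact: natcomp_comp.
by move=> n; rewrite hf hg.
Qed.

Lemma cmp_pair {U V} {nU : numbered U} {nV : numbered V} (f : T -> U) (g : T -> V) :
  cmp f -> cmp g -> cmp (fun x => (f x, g x)).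
Proof.
move=> [f' cf hf] [g' cg hg]; exists (fun n => cpair (f' n) (g' n)).
  exact: natcomp_pair.
by move=> n; rewrite nu_pair hf hg.
Qed.

Lemma cmp_fst {U V} {nU : numbered U} {nV : numbered V} (f : T -> U * V) :
  cmp f -> cmp (fun x => (f x).1).
Proof.
move=> [f' cf hf]; exists (fun n => (unpair (f' n)).1).
  exact: natcomp_comp natcomp_fst cf.
by move=> n; rewrite -hf.
Qed.

Lemma cmp_snd {U V} {nU : numbered U} {nV : numbered V} (f : T -> U * V) :
  cmp f -> cmp (fun x => (f x).2).
Proof.
move=> [f' cf hf]; exists (fun n => (unpair (f' n)).2).
  exact: natcomp_comp natcomp_snd cf.
by move=> n; rewrite -hf.
Qed.

Lemma cmp_succ (f : T -> nat) : cmp f -> cmp (fun x => (f x).+1).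
Proof.
move=> [f' cf hf]; exists (fun n => (f' n).+1); first exact: natcomp_comp natcomp_succ cf.
by move=> n; rewrite -hf.
Qed.

Lemma cmp_rec {U} {nU : numbered U} (f : T -> U) (h : T -> nat -> U -> U) (k : T -> nat) :
  cmp f -> cmp (fun z : T * (nat * U) => h z.1 z.2.1 z.2.2) -> cmp k ->
  cmp (fun x => nat_rect (fun=> U) (f x) (h x) (k x)).
Proof.
move=> [f' cf hf] [h' ch hh] [k' ck hk].
exists (fun x => nat_rect (fun=> nat) (f' x) (fun n r => h' (cpair x (cpair n r))) (k' x)).
  exact: natcomp_rec.
move=> n; rewrite -hk /=; elim: (k' n) => [|m IH] /=; first exact: hf.
by rewrite hh !nu_pair /= IH.
Qed.

End Closure.

Section Programs.
Context {T : Type} {nT : numbered T}.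

Lemma cmp_app {A B U} {nA : numbered A} {nB : numbered B} {nU : numbered U}
    (h : A -> B -> U) (f : T -> A) (g : T -> B) :
  cmp (fun z : A * B => h z.1 z.2) -> cmp f -> cmp g -> cmp (fun x => h (f x) (g x)).
Proof.
move=> ch cf cg; exact: (cmp_comp (f := fun z => h z.1 z.2) ch (cmp_pair cf cg)).
Qed.

Lemma cmp_app3 {A B C U} {nA : numbered A} {nB : numbered B} {nC : numbered C}
    {nU : numbered U} (h : A -> B -> C -> U) (f : T -> A) (g : T -> B) (k : T -> C) :
  cmp (fun z : A * (B * C) => h z.1 z.2.1 z.2.2) -> cmp f -> cmp g -> cmp k ->
  cmp (fun x => h (f x) (g x) (k x)).
Proof.
move=> ch cf cg ck.
exact: (cmp_comp (f := fun z => h z.1 z.2.1 z.2.2) ch (cmp_pair cf (cmp_pair cg ck))).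
Qed.

End Programs.

Ltac cmp_core := match goal with
  | H : ?P |- ?P => exact H
  | |- cmp (fun _ => ?c) => refine (cmp_const c)
  | |- cmp (fun x => x) => refine cmp_id
  | |- cmp (fun _ => (_, _)) => refine (cmp_pair _ _)
  | |- cmp (fun _ => fst _) => refine (cmp_fst _)
  | |- cmp (fun _ => snd _) => refine (cmp_snd _)
  | |- cmp fst => refine (cmp_fst cmp_id)
  | |- cmp snd => refine (cmp_snd cmp_id)
  | |- cmp (fun _ => succn _) => refine (cmp_succ _)
  | H : cmp ?f |- cmp (fun x => ?f _) => refine (cmp_comp (f := f) H _)
  | H : cmp (fun z => ?h z.1 z.2) |- cmp (fun x => ?h _ _) =>
      refine (cmp_app (h := h) H _ _)
  | H : cmp (fun z => ?h z.1 z.2.1 z.2.2) |- cmp (fun x => ?h _ _ _) =>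
      refine (cmp_app3 (h := h) H _ _ _)
  end.
Ltac cmp_step := cmp_core.
Ltac cmp_tac := repeat (cbv beta; cmp_step).

(** * Iteration, case distinction and arithmetic of natural numbers *)

Lemma cmp_iter {T U} {nT : numbered T} {nU : numbered U}
    (f : T -> U) (h : T -> U -> U) (k : T -> nat) :
  cmp f -> cmp (fun z : T * U => h z.1 z.2) -> cmp k ->
  cmp (fun x => iter (k x) (h x) (f x)).
Proof.
move=> cf ch ck; apply: (@eq_cmp _ _ _ _ (fun x =>
    nat_rect (fun=> U) (f x) (fun _ => h x) (k x))).
  by move=> x; elim: (k x) => //= n ->.
by apply: cmp_rec => //; apply: (cmp_app (h := h)) => //; cmp_tac.
Qed.

Lemma cmp_if {T U} {nT : numbered T} {nU : numbered U} (b : T -> bool) (f g : T -> U) :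
  cmp b -> cmp f -> cmp g -> cmp (fun x => if b x then f x else g x).
Proof.
(* Every positive number codes [true], so branching is a recursion on the code [b' n] whose step
   ignores the previous value. *)
move=> [b' cb hb] cf cg; enough (cmp (fun z : nat * T =>
    nat_rect (fun=> U) (g z.2) (fun _ _ => f z.2) z.1)) as [h ch hh].
  exists (fun n => h (cpair (b' n) n)).
    exact: natcomp_comp ch (natcomp_pair cb natcomp_id).
  by move=> n; rewrite hh nu_pair /= -hb /=; case: (b' n).
refine (cmp_rec (h := fun z _ _ => f z.2) _ _ _); cmp_tac.
Qed.

Section Booleans.
Context {T : Type} {nT : numbered T}.
Variables b c : T -> bool.
Hypothesis (cb : cmp b) (cc : cmp c).

Lemma cmp_negb : cmp (fun x => ~~ b x).
Proof. by refine (cmp_if (f := fun=> false) _ _ _); cmp_tac. Qed.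

Lemma cmp_andb : cmp (fun x => b x && c x).
Proof. by refine (cmp_if (g := fun=> false) _ _ _); cmp_tac. Qed.

Lemma cmp_orb : cmp (fun x => b x || c x).
Proof. by refine (cmp_if (f := fun=> true) _ _ _); cmp_tac. Qed.

Lemma cmp_implyb : cmp (fun x => b x ==> c x).
Proof. by refine (cmp_if (g := fun=> true) _ _ _); cmp_tac. Qed.
End Booleans.

Ltac cmp_logic := lazymatch goal with
  | |- cmp (fun _ => ~~ _) => refine (cmp_negb _)
  | |- cmp (fun _ => _ && _) => refine (cmp_andb _ _)
  | |- cmp (fun _ => _ || _) => refine (cmp_orb _ _)
  | |- cmp (fun _ => _ ==> _) => refine (cmp_implyb _ _)
  | |- cmp (fun _ => if _ then _ else _) => refine (cmp_if _ _ _)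
  | |- cmp (fun _ => iter _ _ _) => refine (cmp_iter _ _ _)
  end.
Ltac cmp_step ::= first [cmp_core | cmp_logic].

Lemma cmp_pred {T} {nT : numbered T} (f : T -> nat) : cmp f -> cmp (fun x => (f x).-1).
Proof.
move=> cf; apply: (@eq_cmp _ _ _ _ (fun x =>
    nat_rect (fun=> nat) 0 (fun n _ => n) (f x))).
  by move=> x; case: (f x).
by refine (cmp_rec (h := fun _ n _ => n) _ _ _); cmp_tac.
Qed.

Lemma cmp_addn {T} {nT : numbered T} (f g : T -> nat) :
  cmp f -> cmp g -> cmp (fun x => f x + g x).
Proof.
move=> cf cg; apply: (@eq_cmp _ _ _ _ (fun x => iter (f x) (fun n => n.+1) (g x))).
  by move=> x; elim: (f x) => //= n ->.
by cmp_tac.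
Qed.

Lemma cmp_muln {T} {nT : numbered T} (f g : T -> nat) :
  cmp f -> cmp g -> cmp (fun x => f x * g x).
Proof.
move=> cf cg; apply: (@eq_cmp _ _ _ _ (fun x => iter (f x) (fun n => g x + n) 0)).
  by move=> x; elim: (f x) => //= n ->.
by cmp_tac; apply: cmp_addn; cmp_tac.
Qed.

Lemma cmp_subn {T} {nT : numbered T} (f g : T -> nat) :
  cmp f -> cmp g -> cmp (fun x => f x - g x).
Proof.
move=> cf cg; apply: (@eq_cmp _ _ _ _ (fun x => iter (g x) predn (f x))).
  by move=> x; elim: (g x) => [|n IH] /=; rewrite ?subn0// IH subnS.
by cmp_tac; apply: cmp_pred; cmp_tac.
Qed.

Lemma cmp_expn {T} {nT : numbered T} (f g : T -> nat) :
  cmp f -> cmp g -> cmp (fun x => f x ^ g x).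
Proof.
move=> cf cg; apply: (@eq_cmp _ _ _ _ (fun x => iter (g x) (fun n => f x * n) 1)).
  by move=> x; elim: (g x) => //= n ->; rewrite expnS.
by cmp_tac; apply: cmp_muln; cmp_tac.
Qed.

Lemma cmp_eq0 {T} {nT : numbered T} (f : T -> nat) : cmp f -> cmp (fun x => f x == 0).
Proof.
move=> [f' cf hf].
apply: (@eq_cmp _ _ _ _ (fun x => ~~ (0 < f x))); first by move=> x; rewrite lt0n negbK.
by apply: cmp_negb; exists f' => // n; rewrite -hf.
Qed.

Lemma cmp_leq {T} {nT : numbered T} (f g : T -> nat) :
  cmp f -> cmp g -> cmp (fun x => f x <= g x).
Proof. by move=> cf cg; apply: cmp_eq0; exact: cmp_subn. Qed.

Lemma cmp_eqn {T} {nT : numbered T} (f g : T -> nat) :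
  cmp f -> cmp g -> cmp (fun x => f x == g x).
Proof.
move=> cf cg; apply: (@eq_cmp _ _ _ _ (fun x => (f x <= g x) && (g x <= f x))).
  by move=> x; rewrite eqn_leq.
by apply: cmp_andb; exact: cmp_leq.
Qed.

Lemma natcompP (f : nat -> nat) : natcomp f <-> cmp f.
Proof.
split=> [cf|[g cg h]]; first by exists f.
by apply: eq_natcomp cg => n; exact: h.
Qed.

(** * Lists *)

Lemma cmp_nilp {T A} {nT : numbered T} {nA : numbered A} (l : T -> seq A) :
  cmp l -> cmp (fun x => nilp (l x)).
Proof.
move=> [l' cl hl]; have [b cb hb] := cmp_eq0 (cmp_id (T := nat)).
exists (fun n => b (l' n)); first exact: natcomp_comp cb cl.
by move=> n; rewrite hb -hl /nilp size_map /=; case: (l' n).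
Qed.

Lemma cmp_cons {T A} {nT : numbered T} {nA : numbered A} (a : T -> A) (l : T -> seq A) :
  cmp a -> cmp l -> cmp (fun x => a x :: l x).
Proof.
move=> [a' ca ha] [l' cl hl]; exists (fun n => (cpair (a' n) (l' n)).+1).
  exact: natcomp_comp natcomp_succ (natcomp_pair ca cl).
by move=> n; rewrite -ha -hl nu_seqS cpairK.
Qed.

Lemma cmp_behead {T A} {nT : numbered T} {nA : numbered A} (l : T -> seq A) :
  cmp l -> cmp (fun x => behead (l x)).
Proof.
move=> [l' cl hl]; exists (fun n => (unpair (l' n).-1).2).
  apply: natcomp_comp natcomp_snd _.
  by apply/natcompP/cmp_pred/natcompP.
by move=> n; rewrite -hl; case: (l' n) => // m; rewrite nu_seqS.
Qed.

Lemma cmp_head {T A} {nT : numbered T} {nA : numbered A} (d : T -> A) (l : T -> seq A) :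
  cmp d -> cmp l -> cmp (fun x => head (d x) (l x)).
Proof.
move=> [d' cd hd] [l' cl hl].
exists (fun n => if l' n == 0 then d' n else (unpair (l' n).-1).1).
  apply/natcompP/cmp_if; first by apply/cmp_eq0/natcompP.
  - exact/natcompP.
  - apply/natcompP/(natcomp_comp natcomp_fst).
    by apply/natcompP/cmp_pred/natcompP.
by move=> n; rewrite -hl -hd; case: (l' n) => // m; rewrite nu_seqS.
Qed.

Lemma cmp_nu {T U} {nT : numbered T} {nU : numbered U} (f : T -> U) :
  cmp (fun n : nat => f (nu n)) -> cmp f.
Proof. by []. Qed.

Lemma cmp_nuK {T} {nT : numbered T} : cmp (fun n : nat => nu n : T).
Proof. by exists id => //; exact: natcomp_id. Qed.

(** The fold is an iteration on pairs of an accumulator and a remaining list. The code of a list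
    bounds its length, so it can serve as the number of steps, the surplus ones being idle; this is
    why the argument passes to codes. *)
Lemma cmp_foldl {T A B} {nT : numbered T} {nA : numbered A} {nB : numbered B}
    (h : T -> A -> B -> A) (i : T -> A) (l : T -> seq B) :
  cmp (fun z : T * (A * B) => h z.1 z.2.1 z.2.2) -> cmp i -> cmp l ->
  cmp (fun x => foldl (h x) (i x) (l x)).
Proof.
move=> ch ci [l' cl hl]; apply: (cmp_nu (f := fun x => foldl (h x) (i x) (l x))).
pose step (n : nat) (z : A * seq B) :=
  if nilp z.2 then z else (h (@nu T nT n) z.1 (head (@nu B nB 0) z.2), behead z.2).
have cl' : @cmp nat nat _ _ l' by apply/natcompP.
apply: (@eq_cmp _ _ _ _ (fun n : nat => (iter (l' n) (step n) (i (nu n), nu (l' n) : seq B)).1)).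
  move=> n; rewrite -hl.
  have : size (nu (l' n) : seq B) <= l' n by rewrite size_map size_decode_seq.
  elim: (l' n) (nu (l' n) : seq B) (i (nu n)) => [|k IH] [|b s] a // sk.
    by rewrite iterSr; exact: IH.
  by rewrite iterSr; exact: IH.
apply: cmp_fst; apply: cmp_iter => //.
  apply: cmp_pair; first exact: (cmp_comp (f := i) ci cmp_nuK).
  exact: (cmp_comp cmp_nuK cl').
rewrite /step; apply: cmp_if.
- by apply: cmp_nilp; cmp_tac.
- by cmp_tac.
- apply: cmp_pair; last by apply: cmp_behead; cmp_tac.
  apply: (cmp_app3 (h := h)) => //.
  + exact: (cmp_comp cmp_nuK (cmp_fst cmp_id)).
  + by cmp_tac.
  + by apply: cmp_head; cmp_tac.
Qed.

Ltac cmp_nat := lazymatch goal with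
  | |- cmp (fun _ => leq _ _) => refine (cmp_leq _ _)
  | |- cmp (fun _ => eq_op _ _) => refine (cmp_eqn _ _)
  | |- cmp (fun _ => predn _) => refine (cmp_pred _)
  | |- cmp (fun _ => addn _ _) => refine (cmp_addn _ _)
  | |- cmp (fun _ => muln _ _) => refine (cmp_muln _ _)
  | |- cmp (fun _ => subn _ _) => refine (cmp_subn _ _)
  | |- cmp (fun _ => expn _ _) => refine (cmp_expn _ _)
  | |- cmp (fun _ => nilp _) => refine (cmp_nilp _)
  | |- cmp (fun _ => _ :: _) => refine (cmp_cons _ _)
  | |- cmp (fun _ => behead _) => refine (cmp_behead _)
  | |- cmp (fun _ => head _ _) => refine (cmp_head _ _)
  | |- cmp (fun _ => foldl _ _ _) => refine (cmp_foldl _ _ _)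
  end.
Ltac cmp_step ::= first [cmp_core | cmp_logic | cmp_nat].

Section Lists.
Context {T A B : Type} {nT : numbered T} {nA : numbered A} {nB : numbered B}.

Lemma cmp_rev (l : T -> seq A) : cmp l -> cmp (fun x => rev (l x)).
Proof.
move=> cl; apply: (@eq_cmp _ _ _ _ (fun x => foldl (fun s a => a :: s) [::] (l x))).
  by move=> x; rewrite /rev; elim: (l x) [::] => //= a s IH t; rewrite IH.
by cmp_tac.
Qed.

Lemma cmp_size (l : T -> seq A) : cmp l -> cmp (fun x => size (l x)).
Proof.
move=> cl; apply: (@eq_cmp _ _ _ _ (fun x => foldl (fun n a => n.+1) 0 (l x))).
  move=> x; rewrite -[RHS]addn0; elim: (l x) 0 => //= a s IH n.
  by rewrite IH addSnnS.
by cmp_tac.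
Qed.

Lemma cmp_nth (d : T -> A) (l : T -> seq A) (i : T -> nat) :
  cmp d -> cmp l -> cmp i -> cmp (fun x => nth (d x) (l x) (i x)).
Proof.
move=> cd cl ci.
apply: (@eq_cmp _ _ _ _ (fun x => head (d x) (iter (i x) behead (l x)))).
  by move=> x; elim: (i x) (l x) => [|n IH] [|a s] //=; rewrite -?iterS iterSr IH //= nth_nil.
by cmp_tac.
Qed.

End Lists.

Lemma cmp_foldr {T A B} {nT : numbered T} {nA : numbered A} {nB : numbered B}
    (h : T -> B -> A -> A) (i : T -> A) (l : T -> seq B) :
  cmp (fun z : T * (B * A) => h z.1 z.2.1 z.2.2) -> cmp i -> cmp l ->
  cmp (fun x => foldr (h x) (i x) (l x)).
Proof.
move=> ch ci cl; apply: (@eq_cmp _ _ _ _ (fun x =>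
    foldl (fun a b => h x b a) (i x) (rev (l x)))).
  by move=> x; rewrite foldl_rev.
by cmp_tac; apply: cmp_rev.
Qed.

Ltac cmp_list := lazymatch goal with
  | |- cmp (fun _ => rev _) => refine (cmp_rev _)
  | |- cmp (fun _ => size _) => refine (cmp_size _)
  | |- cmp (fun _ => nth _ _ _) => refine (cmp_nth _ _ _)
  | |- cmp (fun _ => foldr _ _ _) => refine (cmp_foldr _ _ _)
  end.
Ltac cmp_step ::= first [cmp_core | cmp_logic | cmp_nat | cmp_list].

Lemma cmp_iota {T} {nT : numbered T} (f g : T -> nat) :
  cmp f -> cmp g -> cmp (fun x => iota (f x) (g x)).
Proof.
move=> cf cg; apply: (@eq_cmp _ _ _ _ (fun x =>
    rev (nat_rect (fun=> seq nat) [::] (fun n s => f x + n :: s) (g x)))).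
  move=> x; elim: (g x) => // n IH.
  by rewrite -[n.+1 in RHS]addn1 iotaD /= rev_cons IH cats1.
apply: cmp_rev; refine (cmp_rec (h := fun x n s => f x + n :: s) _ _ _); cmp_tac.
Qed.

Lemma cmp_map {T A B} {nT : numbered T} {nA : numbered A} {nB : numbered B}
    (h : T -> B -> A) (l : T -> seq B) :
  cmp (fun z : T * B => h z.1 z.2) -> cmp l -> cmp (fun x => map (h x) (l x)).
Proof.
move=> ch cl; apply: (@eq_cmp _ _ _ _ (fun x =>
    foldr (fun b s => h x b :: s) [::] (l x))).
  by move=> x; elim: (l x) => //= b s ->.
by cmp_tac.
Qed.

Lemma cmp_cat {T A} {nT : numbered T} {nA : numbered A} (l m : T -> seq A) :
  cmp l -> cmp m -> cmp (fun x => l x ++ m x).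
Proof.
move=> cl cm; apply: (@eq_cmp _ _ _ _ (fun x => foldr cons (m x) (l x))).
  by move=> x; elim: (l x) => //= b s ->.
by cmp_tac.
Qed.

Lemma cmp_all {T A} {nT : numbered T} {nA : numbered A} (h : T -> A -> bool) (l : T -> seq A) :
  cmp (fun z : T * A => h z.1 z.2) -> cmp l -> cmp (fun x => all (h x) (l x)).
Proof.
move=> ch cl; apply: (@eq_cmp _ _ _ _ (fun x => foldr (fun a b => h x a && b) true (l x))).
  by move=> x; elim: (l x) => //= b s ->.
by cmp_tac.
Qed.

Lemma cmp_has {T A} {nT : numbered T} {nA : numbered A} (h : T -> A -> bool) (l : T -> seq A) :
  cmp (fun z : T * A => h z.1 z.2) -> cmp l -> cmp (fun x => has (h x) (l x)).
Proof.
move=> ch cl; apply: (@eq_cmp _ _ _ _ (fun x => foldr (fun a b => h x a || b) false (l x))).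
  by move=> x; elim: (l x) => //= b s ->.
by cmp_tac.
Qed.

Lemma cmp_take {T A} {nT : numbered T} {nA : numbered A} (k : T -> nat) (l : T -> seq A) :
  cmp k -> cmp l -> cmp (fun x => take (k x) (l x)).
Proof.
move=> ck cl; apply: (@eq_cmp _ _ _ _ (fun x =>
    rev (foldl (fun s a => if size s < k x then a :: s else s) [::] (l x)))).
  move=> x; have gen s t : rev (foldl (fun s a => if size s < k x then a :: s else s) t s)
      = rev t ++ take (k x - size t) s.
    elim: s t => [|a s IH] t; first by rewrite cats0.
    rewrite [foldl _ _ _]/= IH; case: ltnP => h.
      by rewrite rev_cons -cats1 -catA -(subnSK h).
    by rewrite (_ : k x - size t = 0) ?take0; last lia.
  by rewrite gen subn0.
by cmp_tac.
Qed.

(** * Unbounded search *)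

Lemma cmp_mu {T} {nT : numbered T} (b : T -> nat -> bool) (f : T -> nat) :
  cmp (fun z : T * nat => b z.1 z.2) -> (forall x, b x (f x)) ->
  (forall x k, k < f x -> ~~ b x k) -> cmp f.
Proof.
move=> cb h1 h2.
assert (cmp (fun z : T * nat => if b z.1 z.2 then 0 else 1)) as [t ct ht] by cmp_tac.
exists (fun n => f (nu n)) => //.
apply: (natcomp_mu ct) => [n|n k /h2 h].
  by have := ht (cpair n (f (@nu T nT n))); rewrite nu_pair /= h1.
by have := ht (cpair n k); rewrite nu_pair /= (negPf h) => ->.
Qed.

(** Search through all codes until the relation accepts: it accepts [f x], so the search stops, and
    nothing else. No algorithm for [f] itself has to be given. *)
Lemma cmp_graph {T U} {nT : numbered T} {nU : numbered U} (r : T -> U -> bool) (f : T -> U) :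
  cmp (fun z : T * U => r z.1 z.2) -> (forall x, r x (f x)) ->
  (forall x u, r x u -> f x = u) -> cmp f.
Proof.
move=> cr h1 h2.
have ex n : exists k, r (@nu T nT n) (@nu U nU k).
  by have [k hk] := nu_surj (f (@nu T nT n)); exists k; rewrite hk.
exists (fun n => ex_minn (ex n)); last by move=> n; case: ex_minnP => m /h2 ->.
apply/natcompP/(cmp_mu (b := fun n k : nat => r (nu n) (nu k))).
- apply: (cmp_app (h := r)) => //; apply: (cmp_comp cmp_nuK); cmp_tac.
- by move=> n; case: ex_minnP.
- move=> n k; case: ex_minnP => m _ hm km; apply/negP => /hm; lia.
Qed.

Ltac cmp_list2 := lazymatch goal with
  | |- cmp (fun _ => map _ _) => refine (cmp_map _ _)
  | |- cmp (fun _ => _ ++ _) => refine (cmp_cat _ _)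
  | |- cmp (fun _ => all _ _) => refine (cmp_all _ _)
  | |- cmp (fun _ => has _ _) => refine (cmp_has _ _)
  | |- cmp (fun _ => iota _ _) => refine (cmp_iota _ _)
  | |- cmp (fun _ => take _ _) => refine (cmp_take _ _)
  end.
Ltac cmp_step ::= first [cmp_core | cmp_logic | cmp_nat | cmp_list | cmp_list2].

Lemma cmp_dvdn {T} {nT : numbered T} (f g : T -> nat) :
  cmp f -> cmp g -> cmp (fun x => f x %| g x).
Proof.
move=> cf cg; apply: (@eq_cmp _ _ _ _ (fun x =>
    has (fun k => g x == k * f x) (iota 0 (g x).+1))); last by cmp_tac.
move=> x; apply/hasP/idP => [[k _ /eqP ->]|/dvdnP[k e]]; first exact: dvdn_mull.
(* Quotients are searched up to [g x] only. For a zero divisor the given [k] may exceed this bound,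
   but then [g x = 0] and the quotient 0 serves. *)
have [f0|f0] := posnP (f x); first by exists 0; rewrite ?mem_iota// e f0 !muln0.
by exists k; rewrite ?mem_iota ?e//= add0n ltnS leq_pmulr.
Qed.

Lemma cmp_coprime {T} {nT : numbered T} (f g : T -> nat) :
  cmp f -> cmp g -> cmp (fun x => coprime (f x) (g x).+1).
Proof.
move=> cf cg; apply: (@eq_cmp _ _ _ _ (fun x => all (fun d =>
    (d %| f x) && (d %| (g x).+1) ==> (d == 1)) (iota 0 (g x).+2))); last first.
  by cmp_tac; apply: cmp_dvdn; cmp_tac.
move=> x; apply/allP/idP => [h|/eqP h d _].
  have /h : gcdn (f x) (g x).+1 \in iota 0 (g x).+2.
    by rewrite mem_iota /= add0n ltnS dvdn_leq// dvdn_gcdr.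
  by rewrite dvdn_gcdl dvdn_gcdr.
by apply/implyP; rewrite -dvdn_gcd h dvdn1.
Qed.

(** * Rational numbers *)

Local Open Scope ring_scope.

(** A difference of naturals avoids case distinctions on signs, and the successor keeps the
    denominator nonzero, so that every triple codes a rational. *)
Definition rat_of (z : nat * (nat * nat)) : rat := (z.1%:R - z.2.1%:R) / z.2.2.+1%:R.

(* Numerator split into its positive and negative parts, and denominator minus one. *)
Definition rat_nf (q : rat) : nat * (nat * nat) :=
  (if numq q is Posz n then n else 0,
   (if numq q is Negz n then n.+1 else 0, `|denq q|.-1))%N.

Lemma rat_nfK q : rat_of (rat_nf q) = q.
Proof.
rewrite /rat_of; cbn [fst snd rat_nf]; rewrite prednK ?absz_gt0 ?denq_neq0//.
rewrite -[RHS]divq_num_den; congr (_ / _).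
  by case: (numq q) => m; rewrite ?subr0// sub0r NegzE.
by rewrite -[in RHS](gtz0_abs (denq_gt0 q)).
Qed.

#[global] Instance numbered_rat : numbered rat.
Proof.
exists (fun n => rat_of (nu n)) => q.
by have [n hn] := nu_surj (rat_nf q); exists n; rewrite hn rat_nfK.
Defined.

Lemma cmp_rat_of {T} {nT : numbered T} (f : T -> nat * (nat * nat)) :
  cmp f -> cmp (fun x => rat_of (f x)).
Proof. by move=> [g cg hg]; exists g => // n; rewrite -hg. Qed.

(** Rationals and triples share their codes, so both statements unfold to the same one; rational
    operations may be computed on arbitrary fractions. *)
Lemma cmp_rat2 {U} {nU : numbered U} (F : rat -> rat -> U) :
  cmp (fun z : (nat * (nat * nat)) * (nat * (nat * nat)) => F (rat_of z.1) (rat_of z.2)) ->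
  cmp (fun z : rat * rat => F z.1 z.2).
Proof. by []. Qed.

Lemma natSr_neq0 n : n.+1%:R != 0 :> rat.
Proof. by rewrite pnatr_eq0. Qed.

Lemma cmp_addq {T} {nT : numbered T} (f g : T -> rat) :
  cmp f -> cmp g -> cmp (fun x => f x + g x).
Proof.
move=> cf cg; refine (cmp_app (h := fun a b => a + b) _ _ _) => //.
apply: cmp_rat2; apply: (@eq_cmp _ _ _ _ (fun z => rat_of
  (z.1.1 * z.2.2.2.+1 + z.2.1 * z.1.2.2.+1,
   (z.1.2.1 * z.2.2.2.+1 + z.2.2.1 * z.1.2.2.+1, (z.1.2.2.+1 * z.2.2.2.+1).-1)))%N).
  move=> [[a [b c]] [a' [b' c']]]; rewrite /rat_of; cbn [fst snd]; rewrite prednK// !natrD !natrM.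
  move: (natSr_neq0 c) (natSr_neq0 c'); move: (c.+1%:R) (c'.+1%:R) => d d' h h'.
  by field; rewrite h h'.
by apply: cmp_rat_of; cmp_tac.
Qed.

Lemma cmp_oppq {T} {nT : numbered T} (f : T -> rat) : cmp f -> cmp (fun x => - f x).
Proof.
move=> cf; refine (cmp_comp (f := fun a => - a) _ _) => //.
have h : @cmp (nat * (nat * nat)) rat _ _ (fun z => - rat_of z); last exact: h.
apply: (@eq_cmp _ _ _ _ (fun z => rat_of (z.2.1, (z.1, z.2.2)))).
  by move=> [a [b c]]; rewrite /rat_of /= -mulNr opprB.
by apply: cmp_rat_of; cmp_tac.
Qed.

Lemma cmp_mulq {T} {nT : numbered T} (f g : T -> rat) :
  cmp f -> cmp g -> cmp (fun x => f x * g x).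
Proof.
move=> cf cg; refine (cmp_app (h := fun a b => a * b) _ _ _) => //.
apply: cmp_rat2; apply: (@eq_cmp _ _ _ _ (fun z => rat_of
  (z.1.1 * z.2.1 + z.1.2.1 * z.2.2.1,
   (z.1.1 * z.2.2.1 + z.1.2.1 * z.2.1, (z.1.2.2.+1 * z.2.2.2.+1).-1)))%N).
  move=> [[a [b c]] [a' [b' c']]]; rewrite /rat_of; cbn [fst snd]; rewrite prednK// !natrD !natrM.
  move: (natSr_neq0 c) (natSr_neq0 c'); move: (c.+1%:R) (c'.+1%:R) => d d' h h'.
  by field; rewrite h h'.
by apply: cmp_rat_of; cmp_tac.
Qed.

Lemma cmp_leqq {T} {nT : numbered T} (f g : T -> rat) :
  cmp f -> cmp g -> cmp (fun x => f x <= g x).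
Proof.
move=> cf cg; refine (cmp_app (h := fun a b => a <= b) _ _ _) => //.
apply: cmp_rat2; apply: (@eq_cmp _ _ _ _ (fun z =>
  (z.1.1 * z.2.2.2.+1 + z.2.2.1 * z.1.2.2.+1 <= z.2.1 * z.1.2.2.+1 + z.1.2.1 * z.2.2.2.+1)%N)).
  move=> [[a [b c]] [a' [b' c']]]; rewrite /rat_of /=.
  rewrite ler_pdivrMr ?ltr0n// mulrAC ler_pdivlMr ?ltr0n//.
  rewrite -(ler_nat rat) !natrD !natrM !mulrBl.
  by apply/idP/idP; lra.
by cmp_tac.
Qed.

Lemma cmp_ltq {T} {nT : numbered T} (f g : T -> rat) :
  cmp f -> cmp g -> cmp (fun x => f x < g x).
Proof.
move=> cf cg; apply: (@eq_cmp _ _ _ _ (fun x => ~~ (g x <= f x))).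
  by move=> x; rewrite ltNge.
by apply/cmp_negb/cmp_leqq.
Qed.

Lemma cmp_eqq {T} {nT : numbered T} (f g : T -> rat) :
  cmp f -> cmp g -> cmp (fun x => f x == g x).
Proof.
move=> cf cg; apply: (@eq_cmp _ _ _ _ (fun x => (f x <= g x) && (g x <= f x))).
  by move=> x; rewrite eq_le.
by apply: cmp_andb; exact: cmp_leqq.
Qed.

Local Open Scope classical_set_scope.

(** * Completion of a seminormed module *)

Section Completion.
(** A norm over [K] takes its values in [K], while limits of seminorms are taken in [R]; [iota] and
    [abs] translate between the two, uniformly for real and complex scalars. *)
Variables (R : realType) (K : numFieldType) (iota : {rmorphism R -> K}).
Variable abs : K -> R.
Hypothesis normE : forall c : K, `|c| = iota (abs c).
Hypothesis iota_le : forall x y, (iota x <= iota y) = (x <= y).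
Variables (V : lmodType K) (p : V -> R).
Hypothesis pD : forall x y, p (x + y) <= p x + p y.
Hypothesis pZ : forall c x, p (c *: x) = abs c * p x.

Let iota_inj : injective iota.
Proof. by move=> x y e; apply: le_anti; rewrite -!iota_le e lexx. Qed.

Let iota_lt x y : (iota x < iota y) = (x < y).
Proof. by rewrite !lt_def iota_le (inj_eq iota_inj). Qed.

Let abs_ge0 c : 0 <= abs c.
Proof. by rewrite -iota_le -normE rmorph0. Qed.

Let absN1 : abs (- 1) = 1.
Proof. by apply: iota_inj; rewrite -normE normrN1 rmorph1. Qed.

Let abs0 : abs 0 = 0.
Proof. by apply: iota_inj; rewrite -normE normr0 rmorph0. Qed.

Let p0 : p 0 = 0.
Proof. by rewrite -(scale0r 0) pZ abs0 mul0r. Qed.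

Let pN x : p (- x) = p x.
Proof. by rewrite -scaleN1r pZ absN1 mul1r. Qed.

Let p_ge0 x : 0 <= p x.
Proof. by have := pD x (- x); rewrite subrr p0 pN; lra. Qed.

Let p_dist x y : `|p x - p y| <= p (x - y).
Proof.
have h1 := pD (x - y) y; have h2 := pD (y - x) x.
rewrite subrK in h1; rewrite subrK -opprB pN in h2.
by rewrite ler_norml; apply/andP; split; lra.
Qed.

Definition seminorm_cauchy : {pred nat -> V} := fun x => `[< forall e, 0 < e ->
  exists N, forall m n, (N <= m)%N -> (N <= n)%N -> p (x m - x n) < e >].

Lemma seminorm_cauchy_submod : submod_closed seminorm_cauchy.
Proof.
split=> [|c x y].
  by apply/asboolP => e e0; exists 0%N => m n _ _; rewrite subrr p0.
move=> /asboolP cx /asboolP cy; apply/asboolP => e e0.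
(* Dividing by [abs c + 1] also covers [c = 0]. *)
have ac : 0 < abs c + 1 by have := abs_ge0 c; lra.
have [|N hN] := cx (e / 2 / (abs c + 1)); first by rewrite !divr_gt0.
have [|M hM] := cy (e / 2); first by rewrite divr_gt0.
exists (maxn N M) => m n; rewrite !geq_max => /andP[Nm Mm] /andP[Nn Mn].
have -> : (c *: x + y) m - (c *: x + y) n = c *: (x m - x n) + (y m - y n).
  by rewrite scalerBr /= [LHS]/(c *: x m + y m - (c *: x n + y n)) opprD addrACA.
apply: le_lt_trans (pD _ _) _; rewrite pZ.
have := hN _ _ Nm Nn; rewrite ltr_pdivlMr// => h1; have h2 := hM _ _ Mm Mn.
have h3 := p_ge0 (x m - x n).
rewrite (_ : e = e / 2 + e / 2); last by lra.
by apply: ler_ltD h2; apply: le_trans (ltW h1); rewrite mulrC ler_wpM2l// lerDl.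
Qed.

HB.instance Definition _ := GRing.isSubmodClosed.Build _ _ seminorm_cauchy
  seminorm_cauchy_submod.

Record cauchy_seq := CauchySeq
  { cauchy_seq_val :> nat -> V; _ : cauchy_seq_val \in seminorm_cauchy }.

HB.instance Definition _ := [isSub for cauchy_seq_val].
HB.instance Definition _ := [Choice of cauchy_seq by <:].
HB.instance Definition _ := [SubChoice_isSubLmodule of cauchy_seq by <:].

Lemma cauchy_seqP (x : cauchy_seq) e : 0 < e ->
  exists N, forall m n, (N <= m)%N -> (N <= n)%N -> p (x m - x n) < e.
Proof. by case: x => x /= /asboolP; apply. Qed.

Definition lim_seminorm (x : cauchy_seq) : R := lim (p (x n) @[n --> \oo]).

Lemma lim_seminorm_cvg (x : cauchy_seq) : p (x n) @[n --> \oo] --> lim_seminorm x.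
Proof.
apply/cauchy_cvgP/cauchy_exP => e e0.
have [N hN] := cauchy_seqP x e0.
exists (p (x N)); exists N => // n /= Nn.
by rewrite /ball/=; apply: le_lt_trans (p_dist _ _) _; exact: hN.
Qed.

Lemma lim_seminormD (x y : cauchy_seq) :
  lim_seminorm (x + y) <= lim_seminorm x + lim_seminorm y.
Proof.
have cD : p (x n) + p (y n) @[n --> \oo] --> lim_seminorm x + lim_seminorm y.
  by apply: cvgD; exact: lim_seminorm_cvg.
apply: ler_cvg_to (@lim_seminorm_cvg (x + y)) cD _.
by near=> n; exact: pD.
Unshelve. all: by end_near. Qed.

Lemma lim_seminormZ c (x : cauchy_seq) :
  lim_seminorm (c *: x) = abs c * lim_seminorm x.
Proof.
apply: (cvg_unique _ (@lim_seminorm_cvg (c *: x))) => //.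
have : abs c * p (x n) @[n --> \oo] --> abs c * lim_seminorm x.
  by apply: cvgMl_tmp; exact: lim_seminorm_cvg.
by under eq_fun do rewrite -pZ.
Qed.

Lemma lim_seminorm_le (x : cauchy_seq) N a :
  (forall n, (N <= n)%N -> p (x n) <= a) -> lim_seminorm x <= a.
Proof.
move=> h; apply: (cvgr_to_le (@lim_seminorm_cvg x)).
by exists N => // n /= Nn; exact: h.
Qed.

Lemma lim_seminorm_ge0 (x : cauchy_seq) : 0 <= lim_seminorm x.
Proof.
by apply: (cvgr_to_ge (@lim_seminorm_cvg x)); near=> n; exact: p_ge0.
Unshelve. all: by end_near. Qed.

Lemma lim_seminorm0 : lim_seminorm 0 = 0.
Proof. by rewrite -(scale0r 0) lim_seminormZ abs0 mul0r. Qed.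

Lemma lim_seminormN x : lim_seminorm (- x) = lim_seminorm x.
Proof. by rewrite -scaleN1r lim_seminormZ absN1 mul1r. Qed.

Fact const_cauchy v : (fun _ : nat => v) \in seminorm_cauchy.
Proof. by apply/asboolP => e e0; exists 0%N => *; rewrite subrr p0. Qed.

Definition const_seq v := CauchySeq (const_cauchy v).

Lemma lim_seminorm_const v : lim_seminorm (const_seq v) = p v.
Proof. by rewrite /lim_seminorm /=; exact: lim_cst. Qed.

Lemma const_seq_linear : linear const_seq.
Proof. by move=> c x y; apply: val_inj. Qed.

Definition null_seq : {pred cauchy_seq} := [pred x | lim_seminorm x == 0].

Lemma null_seq_zmod : zmod_closed null_seq.
Proof.
split=> [|x y]; rewrite !inE ?lim_seminorm0 ?eqxx// => /eqP x0 /eqP y0.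
have := lim_seminormD x (- y); rewrite lim_seminormN x0 y0 addr0 => h.
by rewrite eq_le h lim_seminorm_ge0.
Qed.

HB.instance Definition _ := GRing.isZmodClosed.Build _ null_seq null_seq_zmod.

Definition completion := Quotient.quot (null_seq : zmodClosed _).
HB.instance Definition _ := GRing.Zmodule.on completion.
Local Notation Q := completion.
Definition compl_proj (x : cauchy_seq) : Q := (\pi_(Quotient.quot (null_seq : zmodClosed _)) x)%qT.
Definition compl_rep (q : Q) : cauchy_seq := generic_quotient.repr q.

Lemma compl_projB : {morph compl_proj : x y / x - y}.
Proof. by move=> x y; rewrite /compl_proj raddfB. Qed.

Lemma compl_projD : {morph compl_proj : x y / x + y}.
Proof. by move=> x y; rewrite /compl_proj raddfD. Qed.

Lemma compl_repK : cancel compl_rep compl_proj.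
Proof. by move=> x; rewrite /compl_proj /compl_rep reprK. Qed.

Lemma compl_proj_eq x y : compl_proj x = compl_proj y <-> lim_seminorm (x - y) = 0.
Proof.
split=> [/eqP|h]; last apply/eqP; rewrite -Quotient.idealrBE inE; first by move/eqP.
exact/eqP.
Qed.

(** [completion] is a quotient by an additive subgroup, so scalars act through representatives.
    Homogeneity of [lim_seminorm] keeps null sequences stable, which makes the action independent of
    the choice. *)
Definition compl_scale (c : K) (q : Q) : Q := compl_proj (c *: compl_rep q).

Lemma compl_proj_scale c x : compl_scale c (compl_proj x) = compl_proj (c *: x).
Proof.
apply/compl_proj_eq; rewrite -scalerBr lim_seminormZ.
by rewrite (_ : lim_seminorm _ = 0) ?mulr0//; apply/compl_proj_eq; rewrite compl_repK.
Qed.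

Fact compl_scaleA a b v : compl_scale a (compl_scale b v) = compl_scale (a * b) v.
Proof. by rewrite -[v]compl_repK !compl_proj_scale scalerA. Qed.

Fact compl_scale1 : left_id 1 compl_scale.
Proof. by move=> v; rewrite -[v]compl_repK !compl_proj_scale scale1r. Qed.

Fact compl_scaleDr : right_distributive compl_scale +%R.
Proof.
move=> a u v; rewrite -[u]compl_repK -[v]compl_repK -compl_projD.
by rewrite !compl_proj_scale -compl_projD scalerDr.
Qed.

Fact compl_scaleDl v : {morph compl_scale^~ v : a b / a + b}.
Proof. by move=> a b; rewrite -[v]compl_repK !compl_proj_scale -compl_projD scalerDl. Qed.

HB.instance Definition _ := GRing.Zmodule_isLmodule.Build K Q
  compl_scaleA compl_scale1 compl_scaleDr compl_scaleDl.

Definition compl_norm (q : Q) : K := iota (lim_seminorm (compl_rep q)).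

Lemma compl_norm_proj x : compl_norm (compl_proj x) = iota (lim_seminorm x).
Proof.
have h u v : lim_seminorm (u - v) = 0 -> lim_seminorm u <= lim_seminorm v.
  by move=> e; have := lim_seminormD (u - v) v; rewrite subrK e add0r.
congr (iota _); apply: le_anti.
have e : lim_seminorm (compl_rep (compl_proj x) - x) = 0 by apply/compl_proj_eq; rewrite compl_repK.
by rewrite !h// -opprB lim_seminormN.
Qed.

Fact compl_normD x y : compl_norm (x + y) <= compl_norm x + compl_norm y.
Proof.
rewrite -[x]compl_repK -[y]compl_repK -compl_projD !compl_norm_proj.
by rewrite -rmorphD iota_le lim_seminormD.
Qed.

Fact compl_normZ c (x : Q) : compl_norm (c *: x) = `|c| * compl_norm x.
Proof.
by rewrite -[x]compl_repK [_ *: _]compl_proj_scale !compl_norm_proj lim_seminormZ rmorphM normE.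
Qed.

Fact compl_norm_eq0 x : compl_norm x = 0 -> x = 0.
Proof.
rewrite -[x]compl_repK compl_norm_proj -(rmorph0 iota) => /iota_inj h.
have -> : (0 : Q) = compl_proj 0 by have := compl_projB 0 0; rewrite !subrr.
by apply/compl_proj_eq; rewrite subr0.
Qed.

HB.instance Definition _ := Lmodule_isNormed.Build K Q
  compl_normD compl_normZ compl_norm_eq0.

Definition compl_emb (v : V) : Q := compl_proj (const_seq v).

Fact compl_emb_linear : linear compl_emb.
Proof.
by move=> c x y; rewrite /compl_emb const_seq_linear compl_projD -compl_proj_scale.
Qed.
HB.instance Definition _ := GRing.isLinear.Build K V Q _ compl_emb compl_emb_linear.

Lemma norm_compl_emb v : `|compl_emb v| = iota (p v).
Proof. by rewrite -lim_seminorm_const -compl_norm_proj. Qed.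

Lemma norm_proj_emb (x : cauchy_seq) v a N : (forall n, (N <= n)%N -> p (x n - v) <= a) ->
  `|compl_proj x - compl_emb v| <= iota a.
Proof.
move=> h; rewrite -compl_projB [`| _ |]compl_norm_proj iota_le.
exact: (lim_seminorm_le (N := N)).
Qed.

(** A positive scalar equals its own norm and is therefore real; this turns every epsilon in [K]
    into one in [R]. *)
Let pos_iota (e : K) : 0 < e -> exists2 r, e = iota r & 0 < r.
Proof.
move=> e0; have ee : e = iota (abs e) by rewrite -normE gtr0_norm.
by exists (abs e) => //; rewrite -iota_lt -ee rmorph0.
Qed.

Lemma compl_emb_dense (b : Q) (e : K) : 0 < e -> exists v, `|b - compl_emb v| < e.
Proof.
move=> /pos_iota[r ->]; move: r => {}e e0.
have e2 : 0 < e / 2 by lra.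
have [N hN] := cauchy_seqP (compl_rep b) e2.
exists (compl_rep b N); rewrite -[b in `|b - _|]compl_repK.
apply: (@le_lt_trans _ _ (iota (e / 2))); last by rewrite iota_lt; lra.
by apply: (norm_proj_emb (N := N)) => n Nn; apply/ltW/hN.
Qed.

(** By density the filter can be followed along embedded vectors: it contains the ball of radius
    [2 d n] around the image of some [w n]. Balls of one proper filter meet, so the [w n] are Cauchy
    for [p], and their class is the limit. *)
Lemma compl_complete (F : set_system Q) : ProperFilter F -> cauchy F -> cvg F.
Proof.
move=> FF /cauchyP Fc.
pose d n : R := n.+1%:R^-1.
have d0 n : 0 < d n by rewrite invr_gt0 ltr0n.
have id0 n : 0 < iota (d n) by rewrite -(rmorph0 iota) iota_lt.
have dlt e : 0 < e -> exists N, forall n, (N <= n)%N -> d n < e.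
  move=> e0; exists (Num.trunc e^-1).+1 => n Nn.
  rewrite /d invf_plt ?posrE ?ltr0n//; apply: lt_le_trans (truncnS_gt _) _.
  by rewrite ler_nat; apply: leqW.
have hv n : {v | F [set b | `|b - compl_emb v| < iota (d n) + iota (d n)]}.
  apply: cid.
  have [b Fb] := Fc _ (id0 n); have [v bv] := compl_emb_dense b (id0 n).
  exists v; apply: filterS Fb => c; rewrite -ball_normE /= => bc.
  rewrite -(subrKA b); apply: le_lt_trans (ler_normD _ _) _.
  by rewrite distrC ltrD.
pose w n := sval (hv n).
have Fw n := svalP (hv n).
have ww m n : p (w m - w n) < d m + d m + (d n + d n).
  have [b [/= bm bn]] := @filter_ex _ F _ _ (filterI (Fw m) (Fw n)).
  rewrite -iota_lt -norm_compl_emb raddfB/= -(subrKA b) !rmorphD/=.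
  by apply: le_lt_trans (ler_normD _ _) _; rewrite ltrD// distrC.
have wC : w \in seminorm_cauchy.
  apply/asboolP => e e0; have e4 : 0 < e / 4 by lra.
  have [N hN] := dlt _ e4; exists N => m n Nm Nn; apply: lt_trans (ww m n) _.
  by have := hN m Nm; have := hN n Nn; lra.
apply/cvg_ex; exists (compl_proj (CauchySeq wC)).
apply/cvgrPdist_lt => e /pos_iota[r ->]; move: r => {}e e0.
(* Four terms [d], each below [e / 8], bound [p (w n - w N)] by [e / 2]; two more bound the distance
   from the image of [w N] to the filter. *)
have e8 : 0 < e / 8 by lra.
have [N hN] := dlt _ e8.
apply: filterS (Fw N) => b bN.
rewrite -(subrKA (compl_emb (w N))).
apply: le_lt_trans (ler_normD _ _) _.
have -> : e = (e / 2) + (e / 4 + e / 4) by lra.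
rewrite rmorphD/= ler_ltD//.
  apply: (norm_proj_emb (N := N)) => n Nn /=; apply/ltW/(lt_trans (ww _ _)).
  by have := hN n Nn; have := hN N (leqnn N); lra.
rewrite distrC; apply: lt_trans bN _; rewrite -rmorphD iota_lt.
by have := hN N (leqnn N); lra.
Qed.

HB.instance Definition _ := Uniform_isComplete.Build Q compl_complete.

Lemma completion_exists : exists (B : completeNormedModType K) (j : {linear V -> B}),
  (forall v, `|j v| = iota (p v)) /\
  (forall (b : B) (e : K), 0 < e -> exists v, `|b - j v| < e).
Proof.
exists (completion : completeNormedModType K), (compl_emb : {linear V -> Q}).
by split; [exact: norm_compl_emb|exact: compl_emb_dense].
Qed.

End Completion.

(** * Seminorms on rational expressions *)

Definition real_emb (cplx : bool) : {rmorphism RR -> Fsc cplx} :=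
  match cplx return {rmorphism RR -> Fsc cplx} with
  | true => (real_complex RR : {rmorphism RR -> complex RR})
  | false => (idfun : {rmorphism RR -> RR})
  end.

Definition Fabs (cplx : bool) : Fsc cplx -> RR :=
  match cplx return Fsc cplx -> RR with
  | true => fun z => Num.sqrt (complex.Re z ^+ 2 + complex.Im z ^+ 2)
  | false => fun x => `|x|
  end.

Lemma Fabs_norm cplx (c : Fsc cplx) : `|c| = real_emb cplx (Fabs c).
Proof. by case: cplx c => [[a b]|c]. Qed.

Lemma real_emb_le cplx x y : (real_emb cplx x <= real_emb cplx y) = (x <= y).
Proof. by case: cplx => //=; rewrite lecR. Qed.

Definition fq0 cplx : FQ cplx :=
  match cplx return FQ cplx with true => (0, 0) | false => 0 end.
Definition fq1 cplx : FQ cplx :=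
  match cplx return FQ cplx with true => (1, 0) | false => 1 end.
Definition fqN1 cplx : FQ cplx :=
  match cplx return FQ cplx with true => (-1, 0) | false => -1 end.
Definition fq_add cplx : FQ cplx * FQ cplx -> FQ cplx :=
  match cplx return FQ cplx * FQ cplx -> FQ cplx with
  | true => fun z => (z.1.1 + z.2.1, z.1.2 + z.2.2)
  | false => fun z => z.1 + z.2
  end.
Definition fq_mul cplx : FQ cplx * FQ cplx -> FQ cplx :=
  match cplx return FQ cplx * FQ cplx -> FQ cplx with
  | true => fun z => (z.1.1 * z.2.1 - z.1.2 * z.2.2, z.1.1 * z.2.2 + z.1.2 * z.2.1)
  | false => fun z => z.1 * z.2
  end.
Definition fq_nsq cplx : FQ cplx -> rat :=
  match cplx return FQ cplx -> rat with
  | true => fun z => z.1 * z.1 + z.2 * z.2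
  | false => fun z => z * z
  end.

Section EmbeddingLemmas.
Variable cplx : bool.

Lemma FQ_emb0 : FQ_emb (fq0 cplx) = 0.
Proof. by case: cplx => //=; rewrite ?ratr0 ?rmorph0. Qed.

Lemma FQ_emb1 : FQ_emb (fq1 cplx) = 1.
Proof. by case: cplx => //=; rewrite ?rmorph0 ?rmorph1. Qed.

Lemma FQ_embN1 : FQ_emb (fqN1 cplx) = -1.
Proof.
case: cplx => /=; rewrite ?rmorph0 ?rmorphN1//.
by apply/eqP; rewrite eq_complex/= oppr0 !eqxx.
Qed.

Lemma FQ_embD (a b : FQ cplx) : FQ_emb (fq_add (a, b)) = FQ_emb a + FQ_emb b.
Proof. by case: cplx a b => [[a b] [c d]|a b] /=; rewrite !rmorphD. Qed.

Lemma FQ_embM (a b : FQ cplx) : FQ_emb (fq_mul (a, b)) = FQ_emb a * FQ_emb b.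
Proof.
by case: cplx a b => [[a b] [c d]|a b] /=; rewrite !(rmorphN, rmorphD, rmorphM).
Qed.

Lemma FQ_emb_inj : injective (@FQ_emb cplx).
Proof.
case: cplx => [[a b] [c d]|a b] /=; last exact: fmorph_inj.
by case=> /fmorph_inj-> /fmorph_inj->.
Qed.

Lemma FQ_emb_nsq (a : FQ cplx) : Fabs (FQ_emb a) ^+ 2 = ratr (fq_nsq a).
Proof.
case: cplx a => [[a b]|a] /=; last by rewrite real_normK ?num_real// rmorphM.
by rewrite sqr_sqrtr ?addr_ge0 ?sqr_ge0// rmorphD !rmorphM.
Qed.

Lemma FQ_emb_dense (c : Fsc cplx) (e : RR) : 0 < e ->
  exists q : FQ cplx, Fabs (c - FQ_emb q) < e.
Proof.
have dns (x d : RR) : 0 < d -> exists q : rat, `|x - ratr q| < d.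
  move=> d0; have [|q] := @rat_in_itvoo RR (x - d) (x + d); first lra.
  rewrite in_itv/= => /andP[h1 h2]; exists q.
  by rewrite ltr_norml; apply/andP; split; lra.
case: cplx c => [[a b]|c] e0; last by have [q] := dns c e e0; exists q.
have e2 : 0 < e / 2 by lra.
have [q hq] := dns a _ e2; have [r hr] := dns b _ e2; exists (q, r) => /=.
set x := a - _ in hq *; set y := b - _ in hr *.
have -> : e = Num.sqrt (e ^+ 2) by rewrite sqrtr_sqr gtr0_norm.
rewrite ltr_sqrt ?exprn_gt0// -(real_normK (num_real x)) -(real_normK (num_real y)).
by have := normr_ge0 x; have := normr_ge0 y; nra.
Qed.

Lemma Fabs_ge0 (c : Fsc cplx) : 0 <= Fabs c.
Proof. by rewrite -(@real_emb_le cplx) -Fabs_norm rmorph0. Qed.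

Lemma real_emb_inj : injective (real_emb cplx).
Proof. by move=> x y e; apply: le_anti; rewrite -!(@real_emb_le cplx) e lexx. Qed.

Lemma FabsM (c d : Fsc cplx) : Fabs (c * d) = Fabs c * Fabs d.
Proof. by apply: real_emb_inj; rewrite rmorphM -!Fabs_norm normrM. Qed.

Lemma FabsD (c d : Fsc cplx) : Fabs (c + d) <= Fabs c + Fabs d.
Proof. by rewrite -(@real_emb_le cplx) rmorphD -!Fabs_norm ler_normD. Qed.

Lemma FabsN (c : Fsc cplx) : Fabs (- c) = Fabs c.
Proof. by apply: real_emb_inj; rewrite -!Fabs_norm normrN. Qed.

Lemma Fabs0 : Fabs (0 : Fsc cplx) = 0.
Proof. by apply: real_emb_inj; rewrite -!Fabs_norm normr0 rmorph0. Qed.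

Lemma Fabs1 : Fabs (1 : Fsc cplx) = 1.
Proof. by apply: real_emb_inj; rewrite -!Fabs_norm normr1 rmorph1. Qed.

End EmbeddingLemmas.

(** * Formal rational combinations and their decidable linear relations *)

Section FormalExpressions.
Variable cplx : bool.
Local Notation K := (Fsc cplx).
Local Notation E := (rat_expr cplx).

Definition comb (V : lmodType K) (v : nat -> V) (s : E) : V :=
  \sum_(a <- s) FQ_emb a.1 *: v a.2.

Definition vec (s : E) : {poly K} := comb (fun n => 'X^n) s.

Definition scale_expr (q : FQ cplx) (s : E) : E :=
  [seq (fq_mul (q, a.1), a.2) | a <- s].

Definition coef_expr (s : E) (n : nat) : FQ cplx :=
  foldr (fun a x => if a.2 == n then fq_add (a.1, x) else x) (fq0 cplx) s.

(** Generators that do not occur in [s] have coefficient zero, so a finite check is enough. *)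
Definition is_null (s : E) : bool := all (fun a => coef_expr s a.2 == fq0 cplx) s.

(** The relation [s = q t + r u], read in the free vector space. It then holds for the values in
    every presentation. *)
Definition lin_rel (s : E) (q : FQ cplx) (t : E) (r : FQ cplx) (u : E) : bool :=
  is_null (scale_expr (fqN1 cplx) s ++ scale_expr q t ++ scale_expr r u).

Lemma comb_cat (V : lmodType K) (v : nat -> V) s t :
  comb v (s ++ t) = comb v s + comb v t.
Proof. by rewrite /comb big_cat. Qed.

Lemma comb_scale (V : lmodType K) (v : nat -> V) q s :
  comb v (scale_expr q s) = FQ_emb q *: comb v s.
Proof.
by rewrite /comb big_map scaler_sumr; apply: eq_bigr => a _; rewrite FQ_embM scalerA.
Qed.

Lemma coef_vec s n : (vec s)`_n = FQ_emb (coef_expr s n).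
Proof.
rewrite /vec /comb; elim: s => [|a s IH]; first by rewrite big_nil coef0 FQ_emb0.
rewrite big_cons coefD IH coefZ coefXn /= eq_sym.
by case: eqP => _; rewrite ?FQ_embD ?mulr1 ?mulr0 ?add0r.
Qed.

Lemma coef_notin s n : n \notin map snd s -> coef_expr s n = fq0 cplx.
Proof.
elim: s => //= a s IH; rewrite inE negb_or => /andP[h /IH ->].
by rewrite eq_sym (negPf h).
Qed.

Lemma is_nullP s : is_null s <-> vec s = 0.
Proof.
split=> [/allP h|h]; last first.
  apply/allP => a _; apply/eqP/(@FQ_emb_inj cplx).
  by rewrite -coef_vec h coef0 FQ_emb0.
apply/polyP => n; rewrite coef0 coef_vec.
have [/mapP[a /h /eqP e ->]|/coef_notin->] := boolP (n \in map snd s).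
  by rewrite e FQ_emb0.
by rewrite FQ_emb0.
Qed.

Lemma lin_relP s q t r u :
  lin_rel s q t r u <-> vec s = FQ_emb q *: vec t + FQ_emb r *: vec u.
Proof.
rewrite is_nullP /vec !comb_cat !comb_scale FQ_embN1 scaleN1r.
by split=> [/eqP|->]; rewrite ?addNr// addrC subr_eq0 => /eqP.
Qed.

(** The value of an expression factors through the free space: it depends only on the collected
    coefficients. This carries relations between polynomials over to an arbitrary module. *)
Lemma comb_vec (V : lmodType K) (v : nat -> V) s N : {in s, forall a, (a.2 < N)%N} ->
  comb v s = \sum_(i < N) (vec s)`_i *: v i.
Proof.
rewrite /vec /comb; elim: s => [|a s IH] h.
  by rewrite !big_nil big1// => i _; rewrite coef0 scale0r.
rewrite !big_cons {}IH; last by move=> b bs; apply: h; rewrite inE bs orbT.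
have aN : (a.2 < N)%N by apply: h; rewrite mem_head.
under [RHS]eq_bigr do rewrite coefD scalerDl.
rewrite big_split/=; congr (_ + _).
rewrite (bigD1 (Ordinal aN))//= big1 ?addr0; first by rewrite coefZ coefXn eqxx mulr1.
move=> i ia; rewrite coefZ coefXn (_ : (_ == _) = false) ?mulr0 ?scale0r//.
by apply: contraNF ia => /eqP h'; apply/eqP/val_inj.
Qed.

Lemma comb_null (V : lmodType K) (v : nat -> V) s : is_null s -> comb v s = 0.
Proof.
move=> /is_nullP h; rewrite (@comb_vec _ _ _ (\max_(a <- s) a.2).+1).
  by rewrite big1// => i _; rewrite h coef0 scale0r.
by move=> a /= ain; rewrite ltnS (@leq_bigmax_seq _ s predT (fun a => a.2)).
Qed.

Lemma comb_lin_rel (V : lmodType K) (v : nat -> V) s q t r u :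
  lin_rel s q t r u -> comb v s = FQ_emb q *: comb v t + FQ_emb r *: comb v u.
Proof.
move=> /(comb_null v); rewrite !comb_cat !comb_scale FQ_embN1 scaleN1r.
by move/eqP; rewrite addrC subr_eq0 => /eqP.
Qed.

(* The rational bounds [a], [b] replace the moduli of the scalars, which are
   irrational in general when the scalar field is complex. *)
Definition expr_seminorm (p : E -> RR) : Prop :=
  forall s t u q r (a b : rat), 0 <= a -> 0 <= b ->
    fq_nsq q <= a * a -> fq_nsq r <= b * b -> lin_rel s q t r u ->
    p s <= ratr a * p t + ratr b * p u.

End FormalExpressions.

(** * Extending a seminorm from rational to real or complex combinations *)

Section SeminormExtension.
Variable cplx : bool.
Local Notation K := (Fsc cplx).
Local Notation E := (rat_expr cplx).
Variable p : E -> RR.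
Hypothesis pP : expr_seminorm p.

Lemma seminorm_nil : p [::] = 0.
Proof.
have h a : 0 <= a -> p [::] <= ratr a * p [::] + ratr 0 * p [::].
  move=> a0; apply: (@pP _ _ _ (fq0 _) (fq0 _)) => //.
  - by case: cplx => //=; nra.
  - by case: cplx.
(* [a = 0] gives [p [::] <= 0], and [a = 2] gives [p [::] <= 2 * p [::]], hence [0 <= p [::]]. *)
apply: le_anti; have := h 0 (lexx _); have := h (2%:R) isT.
by rewrite rmorph0 ratr_nat !mul0r; lra.
Qed.

Lemma seminorm_ge0 s : 0 <= p s.
Proof.
(* The relation used is [0 = 1 s + (-1) s]. *)
have h : p [::] <= ratr 1 * p s + ratr 1 * p s.
  apply: (@pP _ _ _ (fq1 _) (fqN1 _)) => //.
  - by case: cplx.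
  - by case: cplx.
  - by apply/lin_relP; rewrite FQ_emb1 FQ_embN1 scaleN1r scale1r subrr /vec /comb big_nil.
by move: h; rewrite seminorm_nil rmorph1; lra.
Qed.

(** Each modulus is the infimum of its rational upper bounds, so the inequality with bounds [a], [b]
    passes to the moduli themselves. *)
Lemma seminorm_lin s t u q r : vec s = FQ_emb q *: vec t + FQ_emb r *: vec u ->
  p s <= Fabs (FQ_emb q) * p t + Fabs (FQ_emb r) * p u.
Proof.
move=> /lin_relP h.
have up (x : FQ cplx) (d : RR) : 0 < d -> exists2 a : rat,
    0 <= a /\ fq_nsq x <= a * a & ratr a < Fabs (FQ_emb x) + d.
  move=> d0; have [|a] := @rat_in_itvoo RR (Fabs (FQ_emb x)) (Fabs (FQ_emb x) + d).
    by lra.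
  rewrite in_itv/= => /andP[h1 h2]; exists a => //.
  have x0 := Fabs_ge0 (FQ_emb x); split; first by rewrite -(ler_rat RR) rmorph0; lra.
  by rewrite -(ler_rat RR) rmorphM -FQ_emb_nsq expr2 ler_pM// ltW.
have pt := seminorm_ge0 t; have pu := seminorm_ge0 u.
(* An excess [d] in both bounds costs [d * (p t + p u)]; the added 1 keeps the divisor positive when
   both seminorms vanish. *)
have den : 0 < p t + p u + 1 by lra.
apply/ler_addgt0Pr => e e0.
have d0 : 0 < e / (p t + p u + 1) by rewrite divr_gt0.
have [a [a0 ha] ha'] := up q _ d0; have [b [b0 hb] hb'] := up r _ d0.
apply: le_trans (pP a0 b0 ha hb h) _.
set d := e / _ in d0 ha' hb'.
have de : d * (p t + p u + 1) = e by rewrite /d divfK// gt_eqF.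
have h1 : ratr a * p t <= (Fabs (FQ_emb q) + d) * p t by rewrite ler_wpM2r// ltW.
have h2 : ratr b * p u <= (Fabs (FQ_emb r) + d) * p u by rewrite ler_wpM2r// ltW.
by move: h1 h2; rewrite !mulrDl -de !mulrDr; lra.
Qed.

Lemma seminormZ s t q : vec s = FQ_emb q *: vec t -> p s <= Fabs (FQ_emb q) * p t.
Proof.
move=> h; have := @seminorm_lin s t [::] q (fq0 _).
by rewrite seminorm_nil mulr0 addr0; apply; rewrite FQ_emb0 scale0r addr0.
Qed.

Lemma seminormD s t u : vec s = vec t + vec u -> p s <= p t + p u.
Proof.
move=> h; have := @seminorm_lin s t u (fq1 _) (fq1 _).
by rewrite FQ_emb1 !scale1r Fabs1 !mul1r; exact.
Qed.

Lemma seminorm_vec s t : vec s = vec t -> p s = p t.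
Proof.
have h s' t' : vec s' = vec t' -> p s' <= p t'.
  move=> e; have := @seminormZ s' t' (fq1 _).
  by rewrite FQ_emb1 scale1r Fabs1 mul1r; exact.
by move=> e; apply: le_anti; rewrite !h.
Qed.

Definition unit_expr n : E := [:: (fq1 cplx, n)].

(** The largest seminorm on polynomials taking the value [p (unit_expr i)] at each ['X^i]. *)
Definition coef_norm (v : {poly K}) : RR :=
  \sum_(i < size v) Fabs v`_i * p (unit_expr i).

Lemma coef_norm_widen (v : {poly K}) N : (size v <= N)%N ->
  coef_norm v = \sum_(i < N) Fabs v`_i * p (unit_expr i).
Proof.
move=> h; rewrite /coef_norm (big_ord_widen _ (fun i => Fabs v`_i * p (unit_expr i)) h).
rewrite big_mkcond; apply: eq_bigr => i _; case: ltnP => // hi.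
by rewrite nth_default// Fabs0 mul0r.
Qed.

Lemma coef_norm_ge0 v : 0 <= coef_norm v.
Proof. by apply: sumr_ge0 => i _; rewrite mulr_ge0 ?Fabs_ge0 ?seminorm_ge0. Qed.

Lemma coef_normD v w : coef_norm (v + w) <= coef_norm v + coef_norm w.
Proof.
rewrite !(@coef_norm_widen _ (maxn (size v) (size w))) ?leq_maxl ?leq_maxr//; last first.
  exact: size_polyD.
rewrite -big_split; apply: ler_sum => i _ /=.
by rewrite -mulrDl ler_wpM2r ?seminorm_ge0// coefD FabsD.
Qed.

Lemma coef_normZ c v : coef_norm (c *: v) = Fabs c * coef_norm v.
Proof.
rewrite (@coef_norm_widen _ (size v)) ?size_scale_leq// mulr_sumr.
by apply: eq_bigr => i _; rewrite coefZ FabsM mulrA.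
Qed.

Lemma coef_norm0 : coef_norm 0 = 0.
Proof. by rewrite -(scale0r 0) coef_normZ Fabs0 mul0r. Qed.

(** Since [p s] depends on [vec s] only, [s] may be replaced by the expression [sN] that lists the
    coefficients in order; the triangle inequality then splits off one coefficient at a time. *)
Lemma seminorm_le_coef_norm s : p s <= coef_norm (vec s).
Proof.
pose sN N : E := mkseq (fun i => (coef_expr s i, i)) N.
have vN N : vec (sN N) = \sum_(i < N) (vec s)`_i *: 'X^i.
  rewrite /vec /comb big_map (_ : iota 0 N = index_iota 0 N); last first.
    by rewrite /index_iota subn0.
  rewrite (big_mkord xpredT (fun i => FQ_emb (coef_expr s i) *: 'X^i)).
  by apply: eq_bigr => i _; rewrite coef_vec.
have hN N : p (sN N) <= \sum_(i < N) Fabs (vec s)`_i * p (unit_expr i).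
  elim: N => [|N IH]; first by rewrite big_ord0 /sN /= seminorm_nil.
  rewrite big_ord_recr/= coef_vec; apply: le_trans (lerD IH (lexx _)).
  rewrite -[p (sN N)]mul1r -(Fabs1 cplx) -FQ_emb1; apply: seminorm_lin.
  rewrite !vN big_ord_recr /= FQ_emb1 scale1r; congr (_ + _).
  by rewrite coef_vec /vec /comb big_seq1 FQ_emb1 scale1r.
have e : vec s = vec (sN (size (vec s))) by rewrite vN -poly_def coefK.
by rewrite [p s](seminorm_vec e); exact: hN.
Qed.

(* The infimal convolution of [p] with a weighted l^1 norm that dominates it on
   rational vectors, which is why it restricts to [p] there. *)
Definition ext_set (v : {poly K}) : set RR :=
  [set x | exists s : E, x = p s + coef_norm (v - vec s)].

Definition ext_seminorm (v : {poly K}) : RR := inf (ext_set v).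

Lemma ext_has_inf v : has_inf (ext_set v).
Proof.
split; first by exists (p [::] + coef_norm (v - vec [::])), [::].
by exists 0 => _ [s ->]; rewrite addr_ge0 ?seminorm_ge0 ?coef_norm_ge0.
Qed.

Lemma ext_le v s : ext_seminorm v <= p s + coef_norm (v - vec s).
Proof. by apply: inf_lbound; [exact: (ext_has_inf v).2|exists s]. Qed.

Lemma ext_adherent v e : 0 < e ->
  exists s, p s + coef_norm (v - vec s) < ext_seminorm v + e.
Proof.
move=> e0; have [_ [s ->] h] := inf_adherent e0 (ext_has_inf v).
by exists s.
Qed.

Lemma ext_vec s : ext_seminorm (vec s) = p s.
Proof.
apply: le_anti; apply/andP; split.
  by apply: le_trans (ext_le _ s) _; rewrite subrr coef_norm0 addr0.
apply: lb_le_inf; first exact: (ext_has_inf _).1.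
move=> _ [t ->].
(* [d] represents [s - t], and [p s <= p t + p d], where [p d] is dominated by the l^1 norm of
   [vec s - vec t]. *)
pose d := s ++ scale_expr (fqN1 cplx) t.
have vd : vec d = vec s - vec t by rewrite /vec comb_cat comb_scale FQ_embN1 scaleN1r.
rewrite -vd; apply: le_trans (lerD (lexx _) (seminorm_le_coef_norm d)).
by apply: seminormD; rewrite vd addrC subrK.
Qed.

Lemma extD v w : ext_seminorm (v + w) <= ext_seminorm v + ext_seminorm w.
Proof.
apply/ler_addgt0Pr => e e0; have e2 : 0 < e / 2 by lra.
have [s hs] := ext_adherent v e2; have [t ht] := ext_adherent w e2.
have vst : vec (s ++ t) = vec s + vec t by rewrite /vec comb_cat.
have h1 := ext_le (v + w) (s ++ t).
have h2 : p (s ++ t) <= p s + p t by exact: seminormD.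
have h3 := coef_normD (v - vec s) (w - vec t).
rewrite vst opprD addrACA in h1; lra.
Qed.

(** A nearly optimal [s] for [v] is multiplied by a rational scalar [q] near [c], and
    [c v - q s = c (v - s) + (c - q) s]. The scalar [q] is chosen after [s], because the closeness
    it needs depends on the size [S] of [s]. Each half of [e] pays for one of the two
    approximations. *)
Lemma ext_scale_le c v : ext_seminorm (c *: v) <= Fabs c * ext_seminorm v.
Proof.
apply/ler_addgt0Pr => e e0.
have c0 := Fabs_ge0 c; have c1 : 0 < Fabs c + 1 by lra.
have [|s hs] := @ext_adherent v (e / 2 / (Fabs c + 1)); first by rewrite !divr_gt0.
have s0 := seminorm_ge0 s; have cs0 := coef_norm_ge0 (vec s).
set d := e / 2 / (Fabs c + 1) in hs.
have de : d * (Fabs c + 1) = e / 2 by rewrite /d divfK// gt_eqF.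
have d0 : 0 < d by rewrite !divr_gt0.
pose S := p s + coef_norm (vec s) + 1.
have S0 : 0 < S by rewrite /S; lra.
have [|q hq] := @FQ_emb_dense _ c (e / 2 / S); first by rewrite !divr_gt0.
set f := e / 2 / S in hq.
have fe : f * S = e / 2 by rewrite /f divfK// gt_eqF.
have f0 : 0 < f by rewrite !divr_gt0.
have h1 := ext_le (c *: v) (scale_expr q s).
have h2 : p (scale_expr q s) <= Fabs (FQ_emb q) * p s.
  by apply: seminormZ; rewrite /vec comb_scale.
have eq1 : c *: v - vec (scale_expr q s) = c *: (v - vec s) + (c - FQ_emb q) *: vec s.
  by rewrite [vec (scale_expr q s)]comb_scale scalerBr scalerBl addrA subrK.
have h3 := coef_normD (c *: (v - vec s)) ((c - FQ_emb q) *: vec s).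
rewrite -eq1 !coef_normZ in h3.
have h4 : Fabs (FQ_emb q) <= Fabs c + f.
  rewrite -(subrK c (FQ_emb q)) addrC; apply: le_trans (FabsD _ _) _.
  by rewrite lerD2l -opprB FabsN ltW.
have h5 : Fabs (FQ_emb q) * p s <= (Fabs c + f) * p s by rewrite ler_wpM2r.
have h6 : Fabs (c - FQ_emb q) * coef_norm (vec s) <= f * coef_norm (vec s).
  by rewrite ler_wpM2r// ltW.
have h7 : Fabs c * (p s + coef_norm (v - vec s)) <= Fabs c * (ext_seminorm v + d).
  by rewrite ler_wpM2l// ltW.
move: fe de h5 h6 h7; rewrite /S !mulrDl !mulrDr; lra.
Qed.

Lemma extZ c v : ext_seminorm (c *: v) = Fabs c * ext_seminorm v.
Proof.
apply: le_anti; rewrite ext_scale_le /=.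
have [->|c0] := eqVneq c 0.
  rewrite Fabs0 mul0r; apply: lb_le_inf; first exact: (ext_has_inf _).1.
  by move=> _ [s ->]; rewrite addr_ge0 ?seminorm_ge0 ?coef_norm_ge0.
have := ext_scale_le c^-1 (c *: v); rewrite scalerA mulVf// scale1r => h.
have := ler_wpM2l (Fabs_ge0 c) h.
by rewrite mulrA -FabsM divff// Fabs1 mul1r.
Qed.

Lemma seminorm_Banach : exists (B : completeNormedModType K) (v : nat -> B),
  linearly_dense v /\ forall s, `|expr_val v s| = real_emb cplx (p s).
Proof.
have [B [j [jn jd]]] := completion_exists (@Fabs_norm cplx) (@real_emb_le cplx) extD extZ.
exists B, (fun n => j 'X^n); split; last first.
  move=> s; rewrite -ext_vec -jn /expr_val /vec /comb linear_sum.
  by congr `| _ |; apply: eq_bigr => a _; rewrite linearZ.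
apply/seteqP; split=> // b _ A /nbhs_ballP[e /= e0 he].
have [v hv] := jd b e e0; exists (j v); split; last by apply: he; rewrite -ball_normE.
exists [seq (v`_i, i) | i <- iota 0 (size v)].
rewrite big_map (_ : iota 0 _ = index_iota 0 (size v)) /=; last first.
  by rewrite /index_iota subn0.
rewrite (big_mkord xpredT (fun i => v`_i *: j 'X^i)).
rewrite -{1}[v]coefK poly_def linear_sum; apply: eq_bigr => i _.
by rewrite linearZ.
Qed.

End SeminormExtension.

Ltac cmp_rat := lazymatch goal with
  | |- cmp (fun _ => (_ + _)%R) => refine (cmp_addq _ _)
  | |- cmp (fun _ => (- _)%R) => refine (cmp_oppq _)
  | |- cmp (fun _ => (_ * _)%R) => refine (cmp_mulq _ _)
  | |- cmp (fun _ => (_ <= _)%R) => refine (cmp_leqq _ _)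
  | |- cmp (fun _ => (_ < _)%R) => refine (cmp_ltq _ _)
  | |- cmp (fun _ => eq_op _ _) => refine (cmp_eqq _ _)
  | |- cmp (fun _ => coprime _ _.+1) => refine (cmp_coprime _ _)
  | |- cmp (fun _ => rat_of _) => refine (cmp_rat_of _)
  end.
Ltac cmp_step ::= first [cmp_core | cmp_logic | cmp_nat | cmp_list | cmp_list2 | cmp_rat].

(** * Goedel numbers of rational expressions *)

(** [pickle] of a rational depends on its lowest terms, which an arbitrary code does not display.
    The normal form is the only triple for [q] with one of the two parts zero, so that their sum is
    the absolute numerator, and with this sum coprime to the denominator. These tests are decidable,
    and a search finds it. *)
Lemma cmp_rat_nf {T} {nT : numbered T} (f : T -> rat) :
  cmp f -> cmp (fun x => rat_nf (f x)).
Proof.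
move=> cf; refine (cmp_comp (f := rat_nf) _ cf).
apply: (cmp_graph (r := fun q (z : nat * (nat * nat)) => [&& rat_of z == q,
    coprime (z.1 + z.2.1) z.2.2.+1 & (z.1 == 0)%N || (z.2.1 == 0)%N])).
- by cmp_tac.
- move=> q; rewrite rat_nfK eqxx; cbn [fst snd rat_nf].
  rewrite prednK ?absz_gt0 ?denq_neq0//.
  by have := coprime_num_den q; case: (numq q) => m; rewrite ?addn0 ?eqxx ?orbT// => ->.
- move=> q [a [b c]] /and3P[/eqP <-]; cbn [fst snd] => cop ab.
  pose m : int := a%:Z - b%:Z.
  have mab : (`|m| = a + b)%N by rewrite /m; lia.
  have e : rat_of (a, (b, c)) = m%:~R / (c.+1%:Z)%:~R.
    by rewrite /rat_of /m; cbn [fst snd]; rewrite rmorphB.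
  have c1 : coprime `|m| `|c.+1%:Z| by rewrite mab.
  rewrite /rat_nf e coprimeq_num// coprimeq_den//= mul1r /m.
  case/orP: ab => /eqP->.
    by rewrite sub0r; case: b {cop m mab e c1}.
  by rewrite subr0.
Qed.

(* [pickle] of the integer [a - b] when [a] or [b] is zero. *)
Definition int_code (a b : nat) : nat :=
  if b == 0%N then CodeSeq.code [:: CodeSeq.code [:: a]; 0%N]
  else CodeSeq.code [:: 0%N; CodeSeq.code [:: b.-1]].

Lemma pickle_ratE q : pickle q =
  CodeSeq.code [:: int_code (rat_nf q).1 (rat_nf q).2.1; int_code (rat_nf q).2.2.+1 0].
Proof.
have pickle_int m : pickle m = if m is Posz n then int_code n 0 else
    if m is Negz n then int_code 0 n.+1 else 0%N by case: m.
rewrite -[pickle q]/(CodeSeq.code [:: pickle (numq q); pickle (denq q)]).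
congr (CodeSeq.code [:: _; _]).
  by rewrite pickle_int /rat_nf; case: (numq q).
rewrite /rat_nf; cbn [fst snd]; rewrite prednK ?absz_gt0 ?denq_neq0//.
by rewrite pickle_int; case: (denq q) (denq_gt0 q).
Qed.

Lemma cmp_code {T} {nT : numbered T} (l : T -> seq nat) :
  cmp l -> cmp (fun x => CodeSeq.code (l x)).
Proof.
move=> cl; apply: (@eq_cmp _ _ _ _ (fun x => foldr (fun n m => 2 ^ n * (2 * m).+1)%N 0%N (l x))).
  move=> x; rewrite /CodeSeq.code; elim: (l x) => //= n s ->.
  by rewrite mul2n.
by cmp_tac.
Qed.

Lemma cmp_pickle_rat {T} {nT : numbered T} (f : T -> rat) :
  cmp f -> cmp (fun x => pickle (f x)).
Proof.
move=> cf; have cn := cmp_rat_nf cf.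
apply: (@eq_cmp _ _ _ _ (fun x => CodeSeq.code
    [:: int_code (rat_nf (f x)).1 (rat_nf (f x)).2.1; int_code (rat_nf (f x)).2.2.+1 0])).
  by move=> x; rewrite pickle_ratE.
by rewrite /int_code; apply: cmp_code; cmp_tac; do 2 (apply: cmp_code; cmp_tac).
Qed.

#[global] Instance numbered_FQ cplx : numbered (FQ cplx) :=
  match cplx return numbered (FQ cplx) with
  | true => numbered_prod (nA := numbered_rat) (nB := numbered_rat)
  | false => numbered_rat
  end.

Section RationalExpressions.
Variable cplx : bool.

Lemma cmp_fq_add : cmp (@fq_add cplx).
Proof. by case: cplx; rewrite /fq_add; cmp_tac. Qed.

Lemma cmp_fq_mul : cmp (@fq_mul cplx).
Proof. by case: cplx; rewrite /fq_mul; cmp_tac. Qed.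

Lemma cmp_fq_nsq : cmp (@fq_nsq cplx).
Proof. by case: cplx; rewrite /fq_nsq; cmp_tac. Qed.

Lemma cmp_fq_eq : cmp (fun z : FQ cplx * FQ cplx => z.1 == z.2).
Proof.
case: cplx; last by cmp_tac.
apply: (@eq_cmp _ _ _ _ (fun z : (rat * rat) * (rat * rat) =>
    (z.1.1 == z.2.1) && (z.1.2 == z.2.2))); last by cmp_tac.
by move=> [[a b] [c d]].
Qed.

Lemma cmp_pickle_FQ : cmp (fun q : FQ cplx => pickle q).
Proof.
case: cplx; last exact: cmp_pickle_rat cmp_id.
apply: (@eq_cmp _ _ _ _ (fun z : rat * rat => CodeSeq.code [:: pickle z.1; pickle z.2])) => //.
by apply: cmp_code; cmp_tac; apply: cmp_pickle_rat; cmp_tac.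
Qed.

Lemma cmp_pickle_expr {T} {nT : numbered T} (f : T -> rat_expr cplx) :
  cmp f -> cmp (fun x => pickle (f x)).
Proof.
move=> cf; apply: (@eq_cmp _ _ _ _ (fun x =>
  CodeSeq.code (map (fun a => CodeSeq.code [:: pickle a.1; a.2]) (f x)))) => //.
have h := cmp_pickle_FQ.
by apply: cmp_code; cmp_tac; apply: cmp_code; cmp_tac.
Qed.

Lemma cmp_pickle_itv {T} {nT : numbered T} (f : T -> rat * rat) :
  cmp f -> cmp (fun x => pickle (f x)).
Proof.
move=> cf; apply: (@eq_cmp _ _ _ _ (fun x =>
  CodeSeq.code [:: pickle (f x).1; pickle (f x).2])) => //.
by apply: cmp_code; cmp_tac; apply: cmp_pickle_rat; cmp_tac.
Qed.

Lemma cmp_pickle_nat2 {T} {nT : numbered T} (f : T -> nat * nat) :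
  cmp f -> cmp (fun x => pickle (f x)).
Proof.
move=> cf; apply: (@eq_cmp _ _ _ _ (fun x => CodeSeq.code [:: (f x).1; (f x).2])) => //.
by cmp_tac; apply: cmp_code; cmp_tac.
Qed.

(** The diagram element asserting that the norm of [s] lies between [lo] and [hi]. Such codes only
    have to be computed, never decoded, since all conditions quantify over [s], [lo] and [hi]. *)
Definition tcode (s : rat_expr cplx) (lo hi : rat) : nat :=
  pickle (pickle s, pickle (lo, hi)).

Lemma cmp_tcode {T} {nT : numbered T} (s : T -> rat_expr cplx) (lo hi : T -> rat) :
  cmp s -> cmp lo -> cmp hi -> cmp (fun x => tcode (s x) (lo x) (hi x)).
Proof.
move=> cs cl ch; rewrite /tcode.
apply: cmp_pickle_nat2; apply: cmp_pair; first exact: cmp_pickle_expr.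
by apply: cmp_pickle_itv; exact: cmp_pair.
Qed.

Lemma cmp_scale_expr {T} {nT : numbered T} (q : T -> FQ cplx) (s : T -> rat_expr cplx) :
  cmp q -> cmp s -> cmp (fun x => scale_expr (q x) (s x)).
Proof.
move=> cq cs; rewrite /scale_expr; have cm := cmp_fq_mul.
by cmp_tac.
Qed.

Lemma cmp_is_null {T} {nT : numbered T} (s : T -> rat_expr cplx) :
  cmp s -> cmp (fun x => is_null (s x)).
Proof.
move=> cs; rewrite /is_null /coef_expr; have ca := cmp_fq_add; have ce := cmp_fq_eq.
by cmp_tac.
Qed.

Lemma cmp_lin_rel {T} {nT : numbered T} (s t u : T -> rat_expr cplx) (q r : T -> FQ cplx) :
  cmp s -> cmp q -> cmp t -> cmp r -> cmp u ->
  cmp (fun x => lin_rel (s x) (q x) (t x) (r x) (u x)).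
Proof.
move=> cs cq ct cr cu; rewrite /lin_rel; apply: cmp_is_null.
by do ![apply: cmp_cat|apply: cmp_scale_expr|apply: cmp_const|assumption].
Qed.

End RationalExpressions.

(** * Names of presentations *)

Section Names.
Variable cplx : bool.
Local Notation E := (rat_expr cplx).

Lemma pickle_invP (T : countType) n (x : T) : pickle_inv n = Some x <-> pickle x = n.
Proof.
split=> [h|<-]; last exact: pickleK_inv.
by have := pickle_invK (T := T) n; rewrite h.
Qed.

Lemma tcode_inj s lo hi s' lo' hi' :
  @tcode cplx s lo hi = tcode s' lo' hi' -> [/\ s = s', lo = lo' & hi = hi'].
Proof.
move=> /(pcan_inj pickleK)[] /(pcan_inj pickleK) -> /(pcan_inj pickleK).
by case=> -> ->.
Qed.

Definition seminorm_name (p : E -> RR) (f : nat -> nat) : Prop := forall k,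
  (exists i, f i = k) <->
  exists s lo hi, k = tcode s lo hi /\ ratr lo < p s < ratr hi.

Lemma real_emb_lt x y : (real_emb cplx x < real_emb cplx y) = (x < y).
Proof. by rewrite !lt_def real_emb_le (inj_eq (@real_emb_inj cplx)). Qed.

Lemma diagramP (B : completeNormedModType (Fsc cplx)) (v : nat -> B) (p : E -> RR) k :
  (forall s, `|expr_val v s| = real_emb cplx (p s)) ->
  diagram v k <-> exists s lo hi, k = tcode s lo hi /\ ratr lo < p s < ratr hi.
Proof.
move=> vp.
have e s lo hi : ((ratr lo : Fsc cplx) < `|expr_val v s| < ratr hi) =
    (ratr lo < p s < ratr hi).
  by rewrite vp -!(fmorph_rat (real_emb cplx)) !real_emb_lt.
split=> [[m [n [s [lo [hi [-> [/pickle_invP <- [[/pickle_invP <- lh] h]]]]]]]]|].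
  by exists s, lo, hi; rewrite -e.
move=> [s [lo [hi [-> h]]]]; exists (pickle s), (pickle (lo, hi)), s, lo, hi.
rewrite e; split=> //; split; first exact/pickle_invP.
split=> //; split; first exact/pickle_invP.
by rewrite -(ltr_rat RR); case/andP: h; exact: lt_trans.
Qed.

Lemma names_seminormP f : names_Banach_presentation cplx f <->
  exists p : E -> RR, expr_seminorm p /\ seminorm_name p f.
Proof.
split=> [[B [v [_ hf]]]|[p [hp hf]]]; last first.
  have [B [v [dv vp]]] := seminorm_Banach hp.
  exists B, v; split=> // k; rewrite hf.
  by split=> /(diagramP _ vp).
pose p s := Fabs `|expr_val v s|.
have vp s : `|expr_val v s| = real_emb cplx (p s) by rewrite -Fabs_norm normr_id.
exists p; split; last by move=> k; rewrite hf; exact: diagramP.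
move=> s t u q r a b a0 b0 ha hb /(comb_lin_rel v) e.
have bound (x : FQ cplx) (c : rat) : 0 <= c -> fq_nsq x <= c * c ->
    `|FQ_emb x| <= ratr c.
  move=> c0 h; rewrite -(fmorph_rat (real_emb cplx)) Fabs_norm real_emb_le.
  rewrite -(@ler_pXn2r _ 2) ?nnegrE ?Fabs_ge0 ?ler0q//.
  by rewrite FQ_emb_nsq -rmorphXn ler_rat expr2.
rewrite -(@real_emb_le cplx) rmorphD.
rewrite [real_emb _ (ratr a * _)]rmorphM [real_emb _ (ratr b * _)]rmorphM.
rewrite !(fmorph_rat (real_emb cplx)) -!vp.
rewrite [expr_val v s]e; apply: le_trans (ler_normD _ _) _; rewrite !normrZ.
by apply: lerD; apply: ler_wpM2r => //; exact: bound.
Qed.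

(* [listed f s lo hi]: [f] enumerates the assertion [lo < |s| < hi]. *)
Definition listed (f : nat -> nat) (s : E) (lo hi : rat) := exists i, f i = tcode s lo hi.

(** For each [s] these are the axioms of a cut presented by rational intervals: [name_small] locates
    the real number, while [name_widen] and [name_round] make the listed intervals exactly the open
    ones around it. [name_lin] states the seminorm inequality through endpoints alone; its instance
    [s = 1 s + 0 s] says that the intervals listed for one expression are mutually consistent. *)
Record name_conditions (f : nat -> nat) : Prop := {
  name_code : forall i, exists (s : E) lo hi, f i = tcode s lo hi;
  name_small : forall s (d : rat), 0 < d -> exists lo hi, listed f s lo hi /\ hi < lo + d;
  name_widen : forall s lo hi lo' hi', listed f s lo' hi' -> lo < lo' -> hi' < hi ->
    listed f s lo hi;
  name_round : forall s lo hi, listed f s lo hi ->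
    exists lo' hi', [/\ listed f s lo' hi', lo < lo' & hi' < hi];
  name_lin : forall s t u q r (a b : rat) lo hi lo1 hi1 lo2 hi2,
    [&& 0 <= a, 0 <= b, fq_nsq q <= a * a, fq_nsq r <= b * b & lin_rel s q t r u] ->
    listed f s lo hi -> listed f t lo1 hi1 -> listed f u lo2 hi2 ->
    lo < a * hi1 + b * hi2 }.

Lemma seminorm_name_conditions p f : expr_seminorm p -> seminorm_name p f ->
  name_conditions f.
Proof.
move=> hp hf.
have lP s lo hi : listed f s lo hi <-> ratr lo < p s < ratr hi.
  split=> [/hf[s' [lo' [hi' [/tcode_inj[-> -> ->]]]]]//|h].
  by apply/hf; exists s, lo, hi.
split.
- move=> i; have /hf[s [lo [hi [-> _]]]] : exists j, f j = f i by exists i.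
  by exists s, lo, hi.
- move=> s d d0.
  have rd : (0 : RR) < ratr d by rewrite ltr0q.
  have [|lo] := @rat_in_itvoo RR (p s - ratr d / 2) (p s); first by lra.
  have [|hi] := @rat_in_itvoo RR (p s) (p s + ratr d / 2); first by lra.
  rewrite !in_itv/= => /andP[h1 h2] /andP[h3 h4]; exists lo, hi; split.
    by apply/lP/andP.
  by rewrite -(ltr_rat RR) rmorphD/=; lra.
- move=> s lo hi lo' hi' /lP/andP[h1 h2] h3 h4; apply/lP.
  by rewrite (lt_trans _ h1) ?(lt_trans h2) ?ltr_rat.
- move=> s lo hi /lP/andP[h1 h2].
  have [lo' h3] := rat_in_itvoo h1; have [hi' h4] := rat_in_itvoo h2.
  move: h3 h4; rewrite !in_itv/= => /andP[h3 h4] /andP[h5 h6].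
  exists lo', hi'; rewrite -!(ltr_rat RR); split=> //.
  by apply/lP/andP.
- move=> s t u q r a b lo hi lo1 hi1 lo2 hi2 /and5P[a0 b0 ha hb st].
  move=> /lP/andP[h1 _] /lP/andP[_ h2] /lP/andP[_ h3].
  rewrite -(ltr_rat RR) rmorphD !rmorphM/=.
  apply: lt_le_trans h1 (le_trans (hp _ _ _ _ _ _ _ a0 b0 ha hb st) _).
  by apply: lerD; apply: ler_wpM2l; rewrite ?ler0q// ltW.
Qed.

Lemma name_conditions_seminorm f : name_conditions f ->
  exists p : E -> RR, expr_seminorm p /\ seminorm_name p f.
Proof.
move=> [hcode hsmall hwiden hround hlin].
(* The relation [s = 1 s + 0 s] in [name_lin]: every listed lower endpoint lies below every listed
   upper one, so the supremum of the lower endpoints exists. *)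
have sep s lo hi lo' hi' : listed f s lo hi -> listed f s lo' hi' -> lo < hi'.
  move=> h1 h2; have := @hlin s s s (fq1 _) (fq0 _) 1 0 _ _ _ _ _ _ _ h1 h2 h2.
  rewrite !mul1r !mul0r addr0; apply; apply/and5P; split=> //.
  - by case: cplx.
  - by case: cplx.
  - by apply/lin_relP; rewrite FQ_emb1 FQ_emb0 scale1r scale0r addr0.
pose L s : set RR := [set x | exists lo hi, x = ratr lo /\ listed f s lo hi].
pose p s := sup (L s).
have Lsup s : has_sup (L s).
  have [lo [hi [h _]]] := hsmall s 1 isT.
  split; first by exists (ratr lo), lo, hi.
  exists (ratr hi) => _ [lo' [hi' [-> h']]]; rewrite ler_rat.
  exact: ltW (sep _ _ _ _ _ h' h).
have lp s lo hi : listed f s lo hi -> ratr lo < p s < ratr hi.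
  move=> /hround[lo' [hi' [h h1 h2]]]; apply/andP; split.
    apply: (@lt_le_trans _ _ (ratr lo')); first by rewrite ltr_rat.
    by apply: sup_upper_bound => //; exists lo', hi'.
  apply: (@le_lt_trans _ _ (ratr hi')); last by rewrite ltr_rat.
  apply: ge_sup; first exact: (Lsup s).1.
  move=> _ [lo2 [hi2 [-> h3]]]; rewrite ler_rat; exact: ltW (sep _ _ _ _ _ h3 h).
have pl s lo hi : ratr lo < p s < ratr hi -> listed f s lo hi.
  move=> /andP[h1 h2].
  (* A listed interval around [p s] shorter than the distance from [p s] to either endpoint lies
     strictly inside the given one, and [name_widen] applies. *)
  have [|d] := @rat_in_itvoo RR 0 (Num.min (p s - ratr lo) (ratr hi - p s)).
    by rewrite lt_min !subr_gt0 h1.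
  rewrite in_itv/= lt_min ltr0q => /and3P[d0 d1 d2].
  have [lo' [hi' [h]]] := hsmall s d d0; have /andP[h3 h4] := lp _ _ _ h.
  rewrite -(ltr_rat RR) rmorphD/= => h5.
  by apply: hwiden h _ _; rewrite -(ltr_rat RR); lra.
exists p; split.
  move=> s t u q r a b a0 b0 ha hb st; apply/ler_addgt0Pr => e e0.
  have ra0 : (0 : RR) <= ratr a by rewrite ler0q.
  have rb0 : (0 : RR) <= ratr b by rewrite ler0q.
  have den : 0 < 1 + ratr a + ratr b :> RR by lra.
  (* With intervals shorter than [d], [p s] exceeds [lo] by less than [d], and [hi1], [hi2] exceed
     [p t], [p u] by less than [d]: the total error is at most [d * (1 + a + b)]. *)
  have [|d] := @rat_in_itvoo RR 0 (e / (1 + ratr a + ratr b)); first by rewrite divr_gt0.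
  rewrite in_itv/= ltr0q ltr_pdivlMr// => /andP[d0 hd].
  have [lo [hi [h h']]] := hsmall s d d0.
  have [lo1 [hi1 [h1 h1']]] := hsmall t d d0.
  have [lo2 [hi2 [h2 h2']]] := hsmall u d d0.
  have := hlin s t u q r a b _ _ _ _ _ _ _ h h1 h2; rewrite a0 b0 ha hb st => /(_ isT).
  have /andP[k1 k2] := lp _ _ _ h; have /andP[k3 k4] := lp _ _ _ h1.
  have /andP[k5 k6] := lp _ _ _ h2.
  move: h' h1' h2'; rewrite -!(ltr_rat RR) !rmorphD !rmorphM/= => h' h1' h2' h3.
  have k7 : ratr a * ratr hi1 <= ratr a * (p t + ratr d) by apply: ler_wpM2l => //; lra.
  have k8 : ratr b * ratr hi2 <= ratr b * (p u + ratr d) by apply: ler_wpM2l => //; lra.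
  by move: hd k7 k8; rewrite !mulrDr mulr1 [ratr d * _]mulrC [ratr d * _]mulrC; lra.
move=> k; split=> [[i <-]|[s [lo [hi [-> h]]]]]; last exact: pl.
have [s [lo [hi e]]] := hcode i; exists s, lo, hi; split=> //.
by apply: lp; exists i.
Qed.

Lemma namesP f : names_Banach_presentation cplx f <-> name_conditions f.
Proof.
rewrite names_seminormP; split=> [[p []]|]; first exact: seminorm_name_conditions.
exact: name_conditions_seminorm.
Qed.

End Names.

(** * Lightface Pi^0_2 predicates *)

Section Pi02Closure.
Local Open Scope nat_scope.

Lemma cmp_cpair {T} {nT : numbered T} (f g : T -> nat) :
  cmp f -> cmp g -> cmp (fun x => cpair (f x) (g x)).
Proof.
move=> cf cg; refine (cmp_app (h := cpair) _ cf cg).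
by exists id; [exact: natcomp_id|move=> n; rewrite /= unpairK].
Qed.

Lemma cmp_unpair {T} {nT : numbered T} (f : T -> nat) : cmp f -> cmp (fun x => unpair (f x)).
Proof.
move=> cf; refine (cmp_comp (f := unpair) _ cf).
by exists id; [exact: natcomp_id|move=> n; rewrite /=; case: (unpair n)].
Qed.

Lemma cmp_code_seq {T} {nT : numbered T} (f : T -> seq nat) :
  cmp f -> cmp (fun x => code_seq (f x)).
Proof.
move=> cf; apply: (@eq_cmp _ _ _ _ (fun x => foldr (fun a r => (cpair a r).+1) 0 (f x))).
  by move=> x; elim: (f x) => //= a s ->.
by cmp_tac; apply: cmp_cpair; cmp_tac.
Qed.

Lemma nu_init_code f m : nu (init_code f m) = mkseq f m :> seq nat.
Proof. by rewrite /nu /= /init_code code_seqK map_id. Qed.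

Lemma total_natcomp e : total e -> exists2 g, natcomp g & forall x, eval e x (g x).
Proof. by move=> /choice[g hg]; exists g => //; exists e. Qed.

Lemma take_mkseq (f : nat -> nat) m n : m <= n -> take m (mkseq f n) = mkseq f m.
Proof. by move=> mn; rewrite /mkseq -map_take take_iota (minn_idPl mn). Qed.

(** The normal form has a single number as witness and as prefix length. The pair [cpair k m] codes
    both witnesses and is at least [m], so the prefix of that length can be cut back to length [m];
    hence [D] need not be monotone in the prefix. *)
Lemma Pi02_intro {X Y} {nX : numbered X} {nY : numbered Y}
    (D : X -> Y -> seq nat -> bool) (P : (nat -> nat) -> Prop) :
  cmp (fun z : X * (Y * seq nat) => D z.1 z.2.1 z.2.2) ->
  (forall f, P f <-> forall x, exists y m, D x y (mkseq f m)) -> Pi02 P.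
Proof.
move=> cD hP.
pose chk (z : nat * (nat * seq nat)) : nat :=
  if D (@nu X nX z.1) (@nu Y nY (unpair z.2.1).1) (take (unpair z.2.1).2 z.2.2) then 0 else 1.
assert (cmp chk) as [g [e he] hg].
  rewrite /chk; cmp_tac.
  - by apply: (cmp_comp cmp_nuK); cmp_tac.
  - by apply: (cmp_comp cmp_nuK); cmp_tac; apply: cmp_unpair; cmp_tac.
  - by apply: cmp_unpair; cmp_tac.
have gE n m f : g (cpair n (cpair m (init_code f m))) = chk (n, (m, mkseq f m)).
  by have := hg (cpair n (cpair m (init_code f m))); rewrite !nu_pair nu_init_code.
have mP m : (unpair m).2 <= m := leq_unpair2 m.
exists e; split; first by move=> x; exists (g x).
move=> f; rewrite hP; split=> h.
  move=> n; have [y [m hD]] := h (nu n); have [k hk] := nu_surj y.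
  exists (cpair k m).
  rewrite (_ : 0 = g (cpair n (cpair (cpair k m) (init_code f (cpair k m)))))//.
  by rewrite gE /chk /= cpairK /= hk take_mkseq ?hD// leq_cpairr.
move=> x; have [n <-] := nu_surj x; have [m hm] := h n.
exists (nu (unpair m).1), (unpair m).2.
have := eval_fun hm (he _); rewrite gE /chk /= take_mkseq//.
by case: ifP.
Qed.

Lemma Pi02_and P Q : Pi02 P -> Pi02 Q -> Pi02 (fun f => P f /\ Q f).
Proof.
move=> [e [/total_natcomp[g cg hg] hP]] [d [/total_natcomp[h ch hh] hQ]].
have cg' : @cmp nat nat _ _ g by apply/natcompP.
have ch' : @cmp nat nat _ _ h by apply/natcompP.
(* The boolean tags which of the two predicates is tested, and [size s == m] forces the witness to
   be the length of the prefix, as in the normal form. *)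
apply: (@Pi02_intro (bool * nat) nat _ _ (fun x m s => (size s == m) &&
  ((if x.1 then g (cpair x.2 (cpair m (code_seq s)))
    else h (cpair x.2 (cpair m (code_seq s)))) == 0))).
  cmp_tac; do ![apply: cmp_cpair|apply: cmp_code_seq]; cmp_tac.
move=> f; split.
  move=> [/hP p /hQ q] [[] n].
    have [m hm] := p n; exists m, m; rewrite size_mkseq eqxx /=.
    by apply/eqP; exact: eval_fun (hg _) hm.
  have [m hm] := q n; exists m, m; rewrite size_mkseq eqxx /=.
  by apply/eqP; exact: eval_fun (hh _) hm.
move=> a; split; [apply/hP => n|apply/hQ => n].
  have [m [k]] := a (true, n); rewrite size_mkseq => /andP[/eqP-> /eqP <-].
  by exists m; exact: hg.
have [m [k]] := a (false, n); rewrite size_mkseq => /andP[/eqP-> /eqP <-].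
by exists m; exact: hh.
Qed.

Lemma eq_Pi02 P Q : (forall f, P f <-> Q f) -> Pi02 P -> Pi02 Q.
Proof.
move=> PQ [e [te he]]; exists e; split=> // f; split=> [/PQ/he//|h].
exact/PQ/he.
Qed.

End Pi02Closure.

(** * Evidence contained in a finite prefix of a name *)

Definition lists (l : seq nat) (i k : nat) : bool := (i < size l)%N && (nth 0%N l i == k).

(** Not the negation of [lists]: a prefix that is too short supports neither. *)
Definition excludes (l : seq nat) (i k : nat) : bool := (i < size l)%N && (nth 0%N l i != k).

Lemma listsP f m i k : lists (mkseq f m) i k <-> (i < m)%N /\ f i = k.
Proof.
rewrite /lists size_mkseq; split=> [/andP[im]|[im <-]].
  by rewrite nth_mkseq// => /eqP.
by rewrite im nth_mkseq// eqxx.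
Qed.

Lemma excludesP f m i k : excludes (mkseq f m) i k <-> (i < m)%N /\ f i <> k.
Proof.
rewrite /excludes size_mkseq; split=> [/andP[im]|[im]].
  by rewrite nth_mkseq// => /eqP.
by rewrite im nth_mkseq// => /eqP.
Qed.

Lemma cmp_lists {T} {nT : numbered T} (l : T -> seq nat) (i k : T -> nat) :
  cmp l -> cmp i -> cmp k -> cmp (fun x => lists (l x) (i x) (k x)).
Proof. by move=> cl ci ck; rewrite /lists; cmp_tac. Qed.

Lemma cmp_excludes {T} {nT : numbered T} (l : T -> seq nat) (i k : T -> nat) :
  cmp l -> cmp i -> cmp k -> cmp (fun x => excludes (l x) (i x) (k x)).
Proof. by move=> cl ci ck; rewrite /excludes; cmp_tac. Qed.

Ltac cmp_names := lazymatch goal with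
  | |- cmp (fun _ => lists _ _ _) => refine (cmp_lists _ _ _)
  | |- cmp (fun _ => excludes _ _ _) => refine (cmp_excludes _ _ _)
  | |- cmp (fun _ => tcode _ _ _) => refine (cmp_tcode _ _ _)
  | |- cmp (fun _ => lin_rel _ _ _ _ _) => refine (cmp_lin_rel _ _ _ _ _)
  | |- cmp (fun _ => fq_nsq _) => refine (cmp_comp (@cmp_fq_nsq _) _)
  end.
Ltac cmp_step ::=
  first [cmp_core | cmp_logic | cmp_names | cmp_nat | cmp_list | cmp_list2 | cmp_rat].

(** * Each condition on names is lightface Pi^0_2 *)

Section UpperBound.
Variable cplx : bool.
Local Notation E := (rat_expr cplx).

Lemma Pi02_code : Pi02 (fun f => forall i, exists (s : E) lo hi, f i = tcode s lo hi).
Proof.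
apply: (@Pi02_intro nat (E * (rat * rat)) _ _ (fun i y l =>
    lists l i (tcode y.1 y.2.1 y.2.2))); first by cmp_tac.
move=> f; split=> h i.
  have [s [lo [hi e]]] := h i; exists (s, (lo, hi)), i.+1; exact/listsP.
by have [[s [lo hi]] [m /listsP[_ e]]] := h i; exists s, lo, hi.
Qed.

Lemma Pi02_small : Pi02 (fun f => forall (s : E) (d : rat), 0 < d ->
  exists lo hi, listed f s lo hi /\ hi < lo + d).
Proof.
apply: (@Pi02_intro (E * rat) (rat * (rat * nat)) _ _ (fun x y l =>
  (0 < x.2) ==> lists l y.2.2 (tcode x.1 y.1 y.2.1) && (y.2.1 < y.1 + x.2))).
  by cmp_tac.
move=> f; split=> [h [s d]|h s d d0] /=.
  have [d0|] := boolP (0 < d); last by exists (0, (0, 0%N)), 0%N.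
  have [lo [hi [[i e] hd]]] := h s d d0; exists (lo, (hi, i)), i.+1.
  by rewrite /= hd andbT; exact/listsP.
have [[lo [hi i]] [m /=]] := h (s, d); rewrite d0 /= => /andP[/listsP[_ e] hd].
by exists lo, hi; split=> //; exists i.
Qed.

(** The premise that an interval is listed hides an existential position. It becomes a universally
    quantified [i], and the implication becomes a disjunction: either [f i] is seen to be another
    code, or the conclusion is witnessed. *)
Lemma Pi02_widen : Pi02 (fun f => forall (s : E) lo hi lo' hi',
  listed f s lo' hi' -> lo < lo' -> hi' < hi -> listed f s lo hi).
Proof.
apply: (@Pi02_intro (E * ((rat * rat) * ((rat * rat) * nat))) nat _ _ (fun x j l =>
  excludes l x.2.2.2 (tcode x.1 x.2.2.1.1 x.2.2.1.2) ||
  ((x.2.1.1 < x.2.2.1.1) && (x.2.2.1.2 < x.2.1.2) ==>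
     lists l j (tcode x.1 x.2.1.1 x.2.1.2)))).
  by cmp_tac.
move=> f; split=> [h [s [[lo hi] [[lo' hi'] i]]]|h s lo hi lo' hi' [i e] h1 h2] /=.
  have [e|ne] := eqVneq (f i) (tcode s lo' hi'); last first.
    by exists 0%N, i.+1; apply/orP; left; apply/excludesP; split=> //; apply/eqP.
  have [/andP[h1 h2]|] := boolP ((lo < lo') && (hi' < hi)); last first.
    by exists 0%N, 0%N; rewrite orbT.
  have [|j ej] := h s lo hi lo' hi' _ h1 h2; first by exists i.
  by exists j, j.+1; apply/orP; right; exact/listsP.
have [j [m /=]] := h (s, ((lo, hi), ((lo', hi'), i))).
by rewrite h1 h2 /= => /orP[/excludesP[]//|/listsP[_ ej]]; exists j.
Qed.

Lemma Pi02_round : Pi02 (fun f => forall (s : E) lo hi, listed f s lo hi ->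
  exists lo' hi', [/\ listed f s lo' hi', lo < lo' & hi' < hi]).
Proof.
apply: (@Pi02_intro (E * ((rat * rat) * nat)) ((rat * rat) * nat) _ _ (fun x y l =>
  excludes l x.2.2 (tcode x.1 x.2.1.1 x.2.1.2) ||
  [&& lists l y.2 (tcode x.1 y.1.1 y.1.2), x.2.1.1 < y.1.1 & y.1.2 < x.2.1.2])).
  by cmp_tac.
move=> f; split=> [h [s [[lo hi] i]]|h s lo hi [i e]] /=.
  have [e|ne] := eqVneq (f i) (tcode s lo hi); last first.
    by exists ((0, 0), 0%N), i.+1; apply/orP; left; apply/excludesP; split=> //; apply/eqP.
  have [|lo' [hi' [[j ej] h1 h2]]] := h s lo hi; first by exists i.
  exists ((lo', hi'), j), j.+1; apply/orP; right; rewrite /= h1 h2 !andbT.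
  exact/listsP.
have [[[lo' hi'] j] [m /=]] := h (s, ((lo, hi), i)).
case/orP=> [/excludesP[]//|/and3P[/listsP[_ ej] h1 h2]].
by exists lo', hi'; split=> //; exists j.
Qed.

Lemma Pi02_lin : Pi02 (fun f => forall (s t u : E) q r (a b : rat) lo hi lo1 hi1 lo2 hi2,
    [&& 0 <= a, 0 <= b, fq_nsq q <= a * a, fq_nsq r <= b * b & lin_rel s q t r u] ->
    listed f s lo hi -> listed f t lo1 hi1 -> listed f u lo2 hi2 ->
    lo < a * hi1 + b * hi2).
Proof.
apply: (@Pi02_intro ((E * (E * E)) * ((FQ cplx * FQ cplx) * ((rat * rat) *
    (((rat * rat) * nat) * (((rat * rat) * nat) * ((rat * rat) * nat)))))) nat _ _
  (fun x _ l =>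
     let: ((s, (t, u)), ((q, r), ((a, b),
       (((lo, hi), i), (((lo1, hi1), i1), ((lo2, hi2), i2)))))) := x in
     [|| excludes l i (tcode s lo hi), excludes l i1 (tcode t lo1 hi1),
         excludes l i2 (tcode u lo2 hi2) |
       [&& 0 <= a, 0 <= b, fq_nsq q <= a * a, fq_nsq r <= b * b & lin_rel s q t r u] ==>
       (lo < a * hi1 + b * hi2)])).
  apply: (@eq_cmp _ _ _ _ (fun z : ((E * (E * E)) * ((FQ cplx * FQ cplx) * ((rat * rat) *
    (((rat * rat) * nat) * (((rat * rat) * nat) * ((rat * rat) * nat)))))) * (nat * seq nat) =>
     let x := z.1 in let l := z.2.2 in
     let I := x.2.2.2 in let I1 := I.2.1 in let I2 := I.2.2 in
     let a := x.2.2.1.1 in let b := x.2.2.1.2 in let q := x.2.1.1 in let r := x.2.1.2 in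
     let s := x.1.1 in let t := x.1.2.1 in let u := x.1.2.2 in
     [|| excludes l I.1.2 (tcode s I.1.1.1 I.1.1.2), excludes l I1.2 (tcode t I1.1.1 I1.1.2),
         excludes l I2.2 (tcode u I2.1.1 I2.1.2) |
       [&& 0 <= a, 0 <= b, fq_nsq q <= a * a, fq_nsq r <= b * b & lin_rel s q t r u] ==>
       (I.1.1.1 < a * I1.1.2 + b * I2.1.2)])).
    by move=> [[[s [t u]] [[q r] [[a b] [[[lo hi] i] [[[lo1 hi1] i1] [[lo2 hi2] i2]]]]]] [y l]].
  by cbv zeta; cmp_tac.
move=> f; split.
  move=> h [[s [t u]] [[q r] [[a b] [[[lo hi] i] [[[lo1 hi1] i1] [[lo2 hi2] i2]]]]]].
  have [e|ne] := eqVneq (f i) (tcode s lo hi); last first.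
    by exists 0%N, i.+1; apply/or4P/Or41/excludesP; split=> //; apply/eqP.
  have [e1|ne] := eqVneq (f i1) (tcode t lo1 hi1); last first.
    by exists 0%N, i1.+1; apply/or4P/Or42/excludesP; split=> //; apply/eqP.
  have [e2|ne] := eqVneq (f i2) (tcode u lo2 hi2); last first.
    by exists 0%N, i2.+1; apply/or4P/Or43/excludesP; split=> //; apply/eqP.
  exists 0%N, 0%N; apply/or4P/Or44/implyP => c.
  by apply: h c _ _ _; [exists i; exact: e|exists i1; exact: e1|exists i2; exact: e2].
move=> h s t u q r a b lo hi lo1 hi1 lo2 hi2 c [i e] [i1 e1] [i2 e2].
have [y [m]] := h ((s, (t, u)), ((q, r), ((a, b),
       (((lo, hi), i), (((lo1, hi1), i1), ((lo2, hi2), i2)))))).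
by rewrite c => /or4P[/excludesP[]|/excludesP[]|/excludesP[]|].
Qed.

Lemma Pi02_names : Pi02 (names_Banach_presentation cplx).
Proof.
have := Pi02_and Pi02_code (Pi02_and Pi02_small (Pi02_and Pi02_widen
  (Pi02_and Pi02_round Pi02_lin))).
apply: eq_Pi02 => f; rewrite namesP.
by split=> [[h1 [h2 [h3 [h4 h5]]]]|[]].
Qed.

End UpperBound.

(** * Hardness through a delayed enumeration for the zero space *)

Section Hardness.
Variable cplx : bool.
Local Notation E := (rat_expr cplx).

Lemma zero_enumeration : exists z : nat -> nat, cmp z /\ forall k, (exists j, z j = k) <->
  exists (s : E) lo hi, k = tcode s lo hi /\ ratr lo < (0 : RR) < ratr hi.
Proof.
pose t (z : E * (rat * rat)) :=
  (* A triple whose interval misses 0 is replaced by a fixed true assertion, so that the enumeration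
     is total and stays inside the diagram. *)
  if (z.2.1 < 0) && (0 < z.2.2) then tcode z.1 z.2.1 z.2.2 else @tcode cplx [::] (-1) 1.
exists (fun j => t (nu j)); split.
  by refine (cmp_comp (f := t) _ cmp_nuK); rewrite /t; cmp_tac; apply: cmp_tcode; cmp_tac.
move=> k; split=> [[j <-]|[s [lo [hi [-> h]]]]].
  rewrite /t; case: ifP => [/andP[h1 h2]|_].
    by do 3 eexists; split; first by []; rewrite ltrq0 ltr0q h1.
  by exists [::], (-1), 1; split=> //; rewrite ltrq0 ltr0q.
have [j e] := nu_surj ((s, (lo, hi)) : E * (rat * rat)); exists j.
by rewrite e /t /= -(ltrq0 RR) -(ltr0q RR) h.
Qed.

Lemma zero_seminorm : expr_seminorm (fun _ : E => 0).
Proof. by move=> *; rewrite !mulr0 addr0. Qed.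

(** The empty expression has norm 0, so the intervals [(-1, i + 1)] alone contribute infinitely many
    codes. *)
Lemma range_names_infinite f (L : seq nat) :
  names_Banach_presentation cplx f -> (forall i, f i \in L) -> False.
Proof.
move=> /names_seminormP[p [hp hf]] hL.
pose h (i : nat) := @tcode cplx [::] (-1) i.+1%:R.
have hin i : h i \in L.
  have [j <-] : exists j, f j = h i; last exact: hL.
  apply/hf; exists [::], (-1), i.+1%:R; split=> //.
  by rewrite seminorm_nil// ltrq0 ltr0q ltr0n ltrN10.
have hinj : injective h.
  by move=> i j /tcode_inj[_ _ /eqP]; rewrite eqr_nat => /eqP[].
have := @uniq_leq_size _ (mkseq h (size L).+1) L.
rewrite mkseq_uniq// size_mkseq ltnn => /(_ isT) H.
suff : false by []; apply: H.
by move=> x /mapP[i _ ->].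
Qed.

Local Open Scope nat_scope.

Lemma names_hard P : Pi02 P ->
  exists F, computable_operator F /\ forall f, P f <-> names_Banach_presentation cplx (F f).
Proof.
move=> [e [/total_natcomp[g cg hg] hP]].
have [z [cz zP]] := zero_enumeration.
have cg' : @cmp nat nat _ _ g by apply/natcompP.
(* The available prefix [l] may be longer than the witness [m], while the normal form reads exactly
   [m] values. *)
pose wit (n : nat) (l : seq nat) (m : nat) := g (cpair n (cpair m (code_seq (take m l)))) == 0.
pose ver (j m : nat) (l : seq nat) := all (fun n => has (wit n l) (iota 0 m.+1)) (iota 0 j.+1).
(* [k] codes an entry [j] together with a search bound [m], so every output is settled by a prefix
   of known length. A failed search repeats [z 0], which belongs to the diagram anyway. *)
pose out (k : nat) (l : seq nat) :=
  if ver (unpair k).1 (unpair k).2 l then z (unpair k).1 else z 0.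
pose F (f : nat -> nat) k := out k (mkseq f (unpair k).2).
have witP f n m m' : m' <= m -> wit n (mkseq f m) m' <->
    eval e (cpair n (cpair m' (init_code f m'))) 0.
  move=> mm; rewrite /wit take_mkseq//; split=> [/eqP h|h].
    by rewrite -[X in eval _ _ X]h; exact: hg.
  by apply/eqP; exact: eval_fun (hg _) h.
have verP f j m : ver j m (mkseq f m) <-> forall n, n <= j ->
    exists2 m', m' <= m & eval e (cpair n (cpair m' (init_code f m'))) 0.
  split=> [/allP h n nj|h].
    have /h/hasP[m'] : n \in iota 0 j.+1 by rewrite mem_iota /= add0n ltnS.
    rewrite mem_iota /= add0n ltnS => mm /witP; exists m' => //; auto.
  apply/allP => n; rewrite mem_iota leq0n add0n ltnS => /h[m' mm hm].
  by apply/hasP; exists m'; [rewrite mem_iota /= add0n ltnS|apply/witP].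
exists F; split; last first.
  move=> f; split=> [/hP h|hS].
    apply/names_seminormP; exists (fun=> 0%R); split; first exact: zero_seminorm.
    move=> k; apply: iff_trans (zP k); split=> [[i <-]|[j <-]].
      by rewrite /F /out; case: ifP => _; eexists.
    have [w hw] := choice h.
    (* The largest of the witnesses for the first [j + 1] instances is a search bound that verifies
       them all. *)
    exists (cpair j (\max_(n < j.+1) w n)); rewrite /F /out !cpairK /=.
    rewrite (_ : ver _ _ _)//; apply/verP => n nj.
    by exists (w n) => //; apply: (leq_bigmax (Ordinal (nj : n < j.+1))).
  apply/hP => n; apply: contrapT => hn.
  (* If instance [n] fails, no entry [j] with [n <= j] is ever released; besides the earlier ones
     only the padding [z 0] occurs, which must be listed separately when [n = 0]. *)
  apply: (range_names_infinite (L := z 0 :: map z (iota 0 n)) hS) => k.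
  rewrite /F /out; case: ifP => [|_]; last by rewrite mem_head.
  move=> /verP hv; rewrite inE map_f ?orbT// mem_iota /= add0n ltnNge.
  by apply/negP => /hv[m _ hm]; apply: hn; exists m.
(* The answer 0 asks for a longer prefix. Cutting longer prefixes back to the required length makes
   all later answers agree. *)
pose prog (y : nat * seq nat) :=
  if (unpair y.1).2 <= size y.2 then (out y.1 (take (unpair y.1).2 y.2)).+1 else 0.
assert (cmp prog) as [G [d hd] hG].
  rewrite /prog /out /ver /wit; cmp_tac;
    do ?[apply: cmp_cpair|apply: cmp_code_seq|apply: cmp_unpair|cbv beta; cmp_step].
have GE k f M : G (cpair k (init_code f M)) = prog (k, mkseq f M).
  by have := hG (cpair k (init_code f M)); rewrite nu_pair nu_init_code.
exists d; split; first by move=> x; exists (G x).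
move=> f k; split.
  exists (unpair k).2; rewrite (_ : (F f k).+1 = G (cpair k (init_code f (unpair k).2)))//.
  by rewrite GE /prog /= size_mkseq leqnn take_mkseq.
move=> M r h; have := eval_fun h (hd _); rewrite GE /prog /= size_mkseq.
by case: leqP => // kM [->]; rewrite take_mkseq.
Qed.

End Hardness.

Theorem theorem2p6 (cplx : bool) :
  Pi02_complete (names_Banach_presentation cplx).
Proof. by split; [exact: Pi02_names|exact: names_hard]. Qed.
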